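(* Let $n\ge2$ and let $B$ be a homothecy invariant convex basis in $\mathbb{R}^n$. Then $B$ possesses the weak Besicovitch property if and only if $B$ is a density basis.
   Context: $L(\mathbb{R}^n)$ is the class of Lebesgue integrable functions on $\mathbb{R}^n$; $|E|$ is Lebesgue measure. A differentiation basis (basis) $B$ in $\mathbb{R}^n$ is a mapping assigning to each $x\in\mathbb{R}^n$ a family $B(x)$ of bounded measurable sets of positive measure containing $x$, such that there is a sequence $(R_k)$ in $B(x)$ with $\operatorname{diam}R_k\to 0$. For $f\in L(\mathbb{R}^n)$, $\overline{D}_B(\int f,x)$ and $\underline{D}_B(\int f,x)$ denote the upper and lower limits of $\frac{1}{|R|}\int_R f$ over $R\in B(x)$ as $\operatorname{diam}R\to 0$. $B$ differentiates $\int f$ if $\overline{D}_B(\int f,x)=\underline{D}_B(\int f,x)=f(x)$ for almost all $x$. $B$ is homothecy invariant if $R\in B(x)$ implies $H(R)\in B(H(x))$ for every homothecy $H$ of $\mathbb{R}^n$ (maps $x\mapsto a+t(x-a)$ with $a\in\mathbb{R}^n$, $t>0$; a homothecy invariant basis is then also translation invariant); convex if all sets in all $B(x)$ are convex; a density basis if $B$ differentiates $\int\chi_E$ for every bounded measurable set $E\subset\mathbb{R}^n$. $B$ possesses the weak Besicovitch property if for every non-negative $f\in L(\mathbb{R}^n)$, at almost every $x\in\mathbb{R}^n$ both implications hold: $\underline{D}_B(\int f,x)\ne f(x)\Rightarrow\underline{D}_B(\int f,x)=-\infty$, and $\overline{D}_B(\int f,x)\ne f(x)\Rightarrow\overline{D}_B(\int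 f,x)=\infty$. *)

(* Defs.v *)
From HB Require Import structures.
From mathcomp Require Import all_boot all_order all_algebra.
From mathcomp Require Import all_classical all_reals all_analysis.

Set Implicit Arguments.
Unset Strict Implicit.
Unset Printing Implicit Defensive.

Import Order.TTheory GRing.Theory Num.Theory.
Import numFieldNormedType.Exports.

Local Open Scope classical_set_scope.
Local Open Scope ring_scope.

(* The library only provides Lebesgue measure on R. On R^n = 'rV[R]_n it is built
   as in dimension one: outer measure by countable covers with half-open boxes,
   then restriction to the Caratheodory sigma-algebra. Measurable thus means
   Lebesgue (not Borel) measurable; convex sets need not be Borel. *)

Section boxes.
Context {R : realType} {n : nat}.
Implicit Types a b : 'rV[R]_n.

Definition box a b : set 'rV[R]_n :=
  [set x | forall i, a 0 i < x 0 i <= b 0 i].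

(* The truncation makes the volume of an empty box 0 as soon as some b_i <= a_i. *)
Definition box_volume a b : R := \prod_(i < n) Num.max 0 (b 0 i - a 0 i).

Lemma box_volume_ge0 a b : 0 <= box_volume a b.
Proof. by apply: prodr_ge0 => i _; rewrite le_max lexx. Qed.

End boxes.

Section lebesgue_outer_measure.
Context (R : realType) (n : nat).
Local Open Scope ereal_scope.

(* Covers are indexed by an arbitrary J : set nat, possibly finite or empty:
   in dimension 0 the only box is the whole space, with volume 1, and set0 must
   still have outer measure 0. *)
Definition box_cover_sum (A : set 'rV[R]_n) : set (\bar R) :=
  [set s | exists (J : set nat) (a b : nat -> 'rV[R]_n),
     A `<=` \bigcup_(k in J) box (a k) (b k) /\
     s = \esum_(k in J) (box_volume (a k) (b k))%:E].

Definition lebesgue_outer (A : set 'rV[R]_n) : \bar R :=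
  ereal_inf (box_cover_sum A).

Let lebesgue_outer_ge0 A : 0 <= lebesgue_outer A.
Proof.
apply: le_ereal_inf_tmp => _ [J [a [b [_ ->]]]].
by apply: esum_ge0 => k _; rewrite lee_fin box_volume_ge0.
Qed.

Let lebesgue_outer0 : lebesgue_outer set0 = 0.
Proof.
apply/eqP; rewrite eq_le lebesgue_outer_ge0 andbT.
apply: ereal_inf_lbound; exists set0, (fun=> 0%R), (fun=> 0%R).
by split; [exact: sub0set | rewrite esum_set0].
Qed.

Let le_lebesgue_outer :
  {homo lebesgue_outer : A B / A `<=` B >-> A <= B}.
Proof.
move=> A B AB; apply: ereal_inf_le_tmp => _ [J [a [b [BJ ->]]]].
by exists J, a, b; split=> //; exact: subset_trans BJ.
Qed.

Let lebesgue_outer_sigma_subadditive : sigma_subadditive lebesgue_outer.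
Proof.
move=> A; have [[i ioo]|] := pselect (exists i, lebesgue_outer (A i) = +oo).
  by rewrite (eseries_pinfty _ _ ioo) ?leey// => k _; rewrite -ltNye
    (lt_le_trans _ (lebesgue_outer_ge0 _)).
rewrite -forallNE => Aoo.
apply/lee_addgt0Pr => e e0.
apply: (le_trans _ (epsilon_trick _ _ (ltW e0))); last first.
  by move=> ?; exact: lebesgue_outer_ge0.
pose P k (c : set nat * (nat -> 'rV[R]_n) * (nat -> 'rV[R]_n)) :=
  A k `<=` \bigcup_(i in c.1.1) box (c.1.2 i) (c.2 i) /\
  \esum_(i in c.1.1) (box_volume (c.1.2 i) (c.2 i))%:E <=
    lebesgue_outer (A k) + (e / (2 ^ k.+1)%:R)%:E.
have [c Pc] : {c & forall k, P k (c k)}.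
  apply: (@choice _ _ P) => k.
  have ek : (0 < e / (2 ^ k.+1)%:R)%R by rewrite divr_gt0// ltr0n expn_gt0.
  have fin : ereal_inf (box_cover_sum (A k)) \is a fin_num.
    by rewrite ge0_fin_numE ?lebesgue_outer_ge0// ltey; apply/eqP/Aoo.
  have [_ [J [a [b [AJ ->]]]] /ltW le] := lb_ereal_inf_adherent ek fin.
  by exists (J, a, b).
have vol0 i j :
    0 <= (box_volume ((c i).1.2 j) ((c i).2 j))%:E by rewrite lee_fin box_volume_ge0.
apply: (@le_trans _ _ (\sum_(i <oo)
    \esum_(j in (c i).1.1) (box_volume ((c i).1.2 j) ((c i).2 j))%:E)); last first.
  by apply: lee_nneseries => [k _ _|k _]; [exact: esum_ge0|exact: (Pc k).2].
rewrite nneseries_esumT; last by move=> k; exact: esum_ge0.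
rewrite esum_esum//.
have /card_esym/ppcard_eqP[f] := card_nat2.
apply: ereal_inf_lbound.
exists [set k | (c (f k).1).1.1 (f k).2],
  (fun k => (c (f k).1).1.2 (f k).2), (fun k => (c (f k).1).2 (f k).2); split.
  move=> x [k _ /(Pc k).1 [j cj xj]].
  by exists (f^-1%FUN (k, j)); rewrite /= invK ?inE.
apply: (@reindex_esum _ _ _ _ _ f); split.
- by move=> k.
- by move=> k l _ _ /(congr1 f^-1%FUN); rewrite !funK ?inE.
- by move=> [i j] [_ /= cij]; exists (f^-1%FUN (i, j)); rewrite /= invK ?inE.
Qed.

HB.instance Definition _ := isOuterMeasure.Build R 'rV[R]_n lebesgue_outer
  lebesgue_outer0 lebesgue_outer_ge0 le_lebesgue_outer
  lebesgue_outer_sigma_subadditive.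

Definition lebesgue_measureRn :
  set (caratheodory_type lebesgue_outer) -> \bar R := lebesgue_outer.

HB.instance Definition _ := isMeasure.Build _ _ _ lebesgue_measureRn
  (@caratheodory_measure0 _ _ lebesgue_outer)
  (@caratheodory_measure_ge0 _ _ lebesgue_outer)
  (@caratheodory_measure_sigma_additive _ _ lebesgue_outer).

End lebesgue_outer_measure.

Section differentiation_bases.
Context {R : realType} {n : nat}.
Local Notation Rn := 'rV[R]_n.
Local Notation mu := (@lebesgue_measureRn R n).
Implicit Types (x : Rn) (A S E : set Rn) (f : Rn -> R).

(* The library norm on 'rV[R]_n is the maximum norm, hence this one. *)
Definition euclidean_norm x : R := Num.sqrt (\sum_(i < n) x 0 i ^+ 2).

Definition diam A : \bar R :=
  ereal_sup [set (euclidean_norm (x.1 - x.2))%:E | x in A `*` A].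

Implicit Type B : Rn -> set (set Rn).

Definition differentiation_basis B : Prop :=
  forall x,
    (forall S, B x S ->
       [/\ bounded_set S, (@lebesgue_outer R n).-cara.-measurable S,
           (0 < mu S)%E & S x]) /\
    (exists S : nat -> set Rn,
       (forall k, B x (S k)) /\ diam (S k) @[k --> \oo] --> 0%E).

Definition mean f S : \bar R := ((mu S)^-1 * \int[mu]_(y in S) (f y)%:E)%E.

(* Upper and lower limits over the S in B x as diam S tends to 0, spelled out as
   inf-sup and sup-inf because set Rn carries no filteredType for limf_esup. *)
Definition upper_derivative B f x : \bar R :=
  ereal_inf [set ereal_sup [set mean f S | S in
    [set S | B x S /\ (diam S < d%:E)%E]] | d in [set d : R | 0 < d]].

Definition lower_derivative B f x : \bar R :=
  ereal_sup [set ereal_inf [set mean f S | S in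
    [set S | B x S /\ (diam S < d%:E)%E]] | d in [set d : R | 0 < d]].

Definition differentiates B f : Prop :=
  {ae mu, forall x, upper_derivative B f x = (f x)%:E /\
                    lower_derivative B f x = (f x)%:E}.

Definition homothecy (a : Rn) (t : R) : Rn -> Rn := fun x => a + t *: (x - a).

Definition homothecy_invariant B : Prop :=
  forall (a : Rn) (t : R), 0 < t ->
  forall x S, B x S -> B (homothecy a t x) (homothecy a t @` S).

Definition convex_basis B : Prop :=
  forall x S, B x S -> convex_set (S : set (convex_lmodType Rn)).

Definition density_basis B : Prop :=
  forall E, bounded_set E -> (@lebesgue_outer R n).-cara.-measurable E ->
  differentiates B \1_E.

Definition Lebesgue_integrable f : Prop :=
  mu.-integrable setT (EFin \o f).

Definition weak_Besicovitch B : Prop :=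
  forall f, Lebesgue_integrable f -> (forall x, 0 <= f x) ->
  {ae mu, forall x,
    (lower_derivative B f x <> (f x)%:E -> lower_derivative B f x = -oo%E) /\
    (upper_derivative B f x <> (f x)%:E -> upper_derivative B f x = +oo%E)}.

End differentiation_bases.

(* Main.v *)
(** Only the implication from density to weak Besicovitch has content. By invariance
    the members at x are the sets x + S with S in B(0), and B(0) is stable under
    dilations. Each convex S is comparable, with constants depending on n alone, to
    a parallelotope [|x M| <= 1]; hence Vitali arguments within one shape cost a
    dimensional factor, although the shapes themselves are uncontrolled.

    A density basis satisfies a weak halo inequality: the points x for which x + S
    meets G in measure above eta |S|, for some S of size at most 1, form a set of
    measure at most C(eta) |G|. Otherwise take sets G violating it ever more badly:
    unions of small copies of G have total measure less than that of a given ball,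
    while their halos at arbitrarily small scales nearly fill it, which contradicts
    the density property of the union.

    If f < upper derivative < oo on a set E of positive outer measure, fix p < q
    between f and the upper derivative, take a small ball nearly filled by a
    measurable hull H of E and let G be the rest of the ball. At x in E some small
    x + S has mean above q while means around points of E are bounded by K and
    f <= p on H. A Calderon-Zygmund stopping argument at the shape of S then shows
    that an enlargement of x + S meets G in a fixed proportion. Two halo
    inequalities bound the part of E in the half ball by a constant times |G|,
    which is a contradiction. The lower derivative is handled by Lebesgue's theorem
    for a single shape (upper bound by f) and by density of {f >= q} (lower bound). *)

Require Import Defs.
From mathcomp Require Import all_boot all_order all_algebra.
From mathcomp Require Import all_classical all_reals all_analysis.
From mathcomp Require Import perm measurable_realfun ring lra.

Set Implicit Arguments.
Unset Strict Implicit.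
Unset Printing Implicit Defensive.

Import Order.TTheory GRing.Theory Num.Theory.
Import numFieldNormedType.Exports.

Local Open Scope classical_set_scope.
Local Open Scope ring_scope.

(** * Vitali selection and comparison of countable families *)

Lemma esumZ_le (R : realType) (I : choiceType) (D : set I) (c : R) (a : I -> \bar R) : 0 <= c ->
  (forall i, (0 <= a i)%E) ->
  (\esum_(i in D) (c%:E * a i) <= c%:E * \esum_(i in D) a i)%E.
Proof.
move=> c0 a0; apply: ge_ereal_sup => _ [A [fA AD] <-].
by rewrite -ge0_mule_fsumr// lee_wpmul2l ?lee_fin//; apply: esum_ge; exists A.
Qed.

(* Zorn's lemma replaces the greedy choice: a maximal admissible subfamily misses no
   [B i], since otherwise a missed one of nearly largest radius could be added. *)
Lemma vitali_selection (R : realType) (T I : Type) (B : I -> set T) (r : I -> R)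
    (V : set I) (rmax : R) :
  (forall i, V i -> 0 < r i <= rmax) -> (forall i, V i -> B i !=set0) ->
  exists D, [/\ D `<=` V, trivIset D B &
    forall i, V i -> exists j, [/\ D j, B i `&` B j !=set0 & r i <= 2 * r j]].
Proof.
move=> r0 B0.
(* The last clause constrains only the sets that meet [D]: each of them must also meet a member of
   at least half its radius. In this form the condition passes to unions of chains, so Zorn's lemma
   applies. *)
pose P (D : set I) := [/\ D `<=` V, trivIset D B &
  forall i j, V i -> D j -> B i `&` B j !=set0 ->
    exists k, [/\ D k, B i `&` B k !=set0 & r i <= 2 * r k]].
have [F FP Ftot|D [[DV tD Dr] maxD]] := @Zorn_bigcup I P.
  split.
  - by move=> i [X /FP[XV _ _] Xi]; exact: XV.
  - move=> i j [X FX Xi] [Y FY Yj].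
    have [XY|YX] := Ftot _ _ FX FY.
      by have [_ tY _] := FP _ FY; apply: tY => //; exact: XY.
    by have [_ tX _] := FP _ FX; apply: tX => //; exact: YX.
  - move=> i j Vi [X FX Xj] Bij; have [_ _ /(_ _ _ Vi Xj Bij)[k [Xk Bik rik]]] := FP _ FX.
    by exists k; split=> //; exists X.
exists D; split=> // i Vi; apply: contrapT => nD.
have {}nD j : D j -> B i `&` B j = set0.
  move=> Dj; apply/eqP/negPn/negP => /set0P Bij; apply: nD.
  exact: Dr Vi Dj Bij.
pose S := [set r k | k in [set k | V k /\ forall j, D j -> B k `&` B j = set0]].
have Si : S (r i) by exists i.
have hS : has_sup S.
  split; first by exists (r i).
  by exists rmax => _ [k [Vk _] <-]; have /andP[] := r0 _ Vk.
have S0 : 0 < sup S.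
  by apply: lt_le_trans (sup_ubound hS.2 Si); have /andP[] := r0 _ Vi.
have S20 : 0 < sup S / 2 by rewrite divr_gt0.
have [_ [k [Vk kD] <-]] := sup_adherent S20 hS.
have -> : sup S - sup S / 2 = sup S / 2 by lra.
move=> rk.
have nDk : ~ D k.
  by move=> /kD; rewrite setIid => Bk; have [x] := B0 _ Vk; rewrite Bk.
apply: (maxD (D `|` [set k])); first by split; [left|move=> /(_ k (or_intror erefl))].
split.
- by move=> j [/DV//|->].
- move=> j l [Dj|->] [Dl|->]//; first exact: tD.
    by rewrite setIC kD// => -[].
  by rewrite kD// => -[].
- move=> j l Vj [Dl|-> Bjk] .
    by move=> /(Dr _ _ Vj Dl)[m [Dm ? ?]]; exists m; split => //; left.
  have [[l' [Dl' Bl']]|nl] := pselect (exists l, D l /\ B j `&` B l !=set0).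
    by have [m [Dm ? ?]] := Dr _ _ Vj Dl' Bl'; exists m; split => //; left.
  exists k; split=> //; first by right.
  have : S (r j).
    exists j => //; split=> // l' Dl'; apply/eqP/negPn/negP => /set0P ?.
    by apply: nl; exists l'.
  by move=> /(sup_ubound hS.2) => h; lra.
Qed.

(** One injection of [D] into [nat] serves every family [C] at once, with [set0] at the missed
    indices. Two families over [D] are thus enumerated in parallel and can be compared term by
    term. *)
Lemma countable_bigcup_nat (X I : Type) (D : set I) : countable D ->
  exists F : (I -> set X) -> nat -> set X,
    [/\ forall C, \bigcup_(i in D) C i = \bigcup_j F C j,
        forall j, (forall C, F C j = set0) \/ exists2 i, D i & forall C, F C j = C i &
        forall C, trivIset D C -> trivIset setT (F C)].
Proof.
move=> /countable_injP[f finj].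
pose F (C : I -> set X) (j : nat) := \bigcup_(i in [set i | D i /\ f i = j]) C i.
exists F; split=> [C|j|C tC].
- apply/seteqP; split=> [x [i Di Cx]|x [j _ [i [Di _] Cx]]]; last by exists i.
  by exists (f i) => //; exists i.
- have [[i [Di fi]]|h] := pselect (exists i, D i /\ f i = j).
    right; exists i => // C; apply/seteqP; split=> [x [i' [Di' fi']]|x Cx].
      by have -> : i' = i by apply: finj; rewrite ?inE// fi fi'.
    by exists i.
  by left=> C; apply/seteqP; split=> // x [i [Di fi] _]; apply: h; exists i.
- move=> i j _ _ [x [[i' [Di' <-] Ci'] [j' [Dj' <-] Cj']]].
  by congr f; apply: tC => //; exists x.
Qed.

Lemma measurable_bigcup_countable d (X : measurableType d) (I : Type) (D : set I)
    (C : I -> set X) :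
  countable D -> (forall i, D i -> measurable (C i)) -> measurable (\bigcup_(i in D) C i).
Proof.
move=> cD mC; have [F [FE Fc _]] := countable_bigcup_nat X cD.
rewrite FE; apply: bigcupT_measurable => j.
by have [->|[i Di ->]] := Fc j; [exact: measurable0|exact: mC].
Qed.

(* [m1] and [m2] are to be outer measures or integrals restricted to a fixed set. *)
Lemma countable_family_le d (X : measurableType d) (R : realType) (I : Type) (D : set I)
    (A B : I -> set X) (m1 m2 : set X -> \bar R) (k : R) : 0 <= k ->
  countable D -> trivIset D B ->
  (forall i, D i -> measurable (A i)) -> (forall i, D i -> measurable (B i)) ->
  m1 set0 = 0%E -> (forall Y, (0 <= m1 Y)%E) -> (forall Y, (0 <= m2 Y)%E) ->
  (forall F : nat -> set X, (forall i, measurable (F i)) ->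
    (m1 (\bigcup_i F i) <= \sum_(i <oo) m1 (F i))%E) ->
  (forall F : nat -> set X, (forall i, measurable (F i)) -> trivIset setT F ->
    (\sum_(i <oo) m2 (F i) <= m2 (\bigcup_i F i))%E) ->
  (forall i, D i -> m1 (A i) <= k%:E * m2 (B i))%E ->
  (m1 (\bigcup_(i in D) A i) <= k%:E * m2 (\bigcup_(i in D) B i))%E.
Proof.
move=> k0 cD tB mA mB m10 m1ge m2ge sub1 sup2 AB.
have [F [FE Fc tF]] := countable_bigcup_nat X cD.
have mF C j : (forall i, D i -> measurable (C i)) -> measurable (F C j).
  by move=> mC; have [->|[i Di ->]] := Fc j; [exact: measurable0|exact: mC].
rewrite !FE; apply: le_trans (sub1 _ _) _; first by move=> j; exact: mF.
apply: (@le_trans _ _ (\sum_(j <oo) k%:E * m2 (F B j))%E).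
  apply: lee_nneseries => [j _ _|j _]; first exact: m1ge.
  have [h|[i Di h]] := Fc j; rewrite !h; last exact: AB.
  by rewrite m10 mule_ge0.
rewrite nneseriesZl//.
by rewrite lee_wpmul2l ?lee_fin// sup2//; [move=> j; exact: mF|exact: tF].
Qed.

Lemma ex_invrS_lt (R : realType) (e : R) : 0 < e -> exists k : nat, k.+1%:R^-1 < e.
Proof. by move=> e0; have [k] := ltr_add_invr e0; rewrite add0r => ?; exists k. Qed.

Section differentiation.
Context {R : realType} {n : nat}.
Local Notation Rn := 'rV[R]_n.
Local Notation lam := (@lebesgue_outer R n).
Local Notation mu := (@lebesgue_measureRn R n).
Local Notation meas := (@lebesgue_outer R n).-cara.-measurable.
Implicit Types (x y z c : Rn) (r s t : R) (A S : set Rn) (M : 'M[R]_n).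

(** * Behaviour of the outer measure under translations and dilations *)

Definition aff (y : Rn) (t : R) (A : set Rn) : set Rn := [set y + t *: x | x in A].

Lemma affE y t A z : t != 0 -> aff y t A z <-> A (t^-1 *: (z - y)).
Proof.
move=> t0; split=> [[x Ax <-]|Az].
  by rewrite addrC addKr scalerA mulVf// scale1r.
by exists (t^-1 *: (z - y)) => //; rewrite scalerA divff// scale1r addrC subrK.
Qed.

Lemma aff_aff y t z s A : aff y t (aff z s A) = aff (y + t *: z) (t * s) A.
Proof.
apply/seteqP; split=> [_ [_ [x Ax <-] <-]|_ [x Ax <-]].
  by exists x => //; rewrite scalerDr addrA scalerA.
by exists (z + s *: x); [exists x|rewrite scalerDr addrA scalerA].
Qed.

Lemma aff01 A : aff 0 1 A = A.
Proof.
by apply/seteqP; split=> [_ [x Ax <-]|x Ax]; [|exists x => //];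
  rewrite add0r scale1r.
Qed.

Lemma affK y t A : t != 0 -> aff (- (t^-1 *: y)) t^-1 (aff y t A) = A.
Proof. by move=> t0; rewrite aff_aff addNr mulVf// aff01. Qed.

Lemma affVK y t A : t != 0 -> aff y t (aff (- (t^-1 *: y)) t^-1 A) = A.
Proof.
by move=> t0; rewrite aff_aff scalerN scalerA divff// scale1r subrr aff01.
Qed.

Lemma aff_sub y t A A' : A `<=` A' -> aff y t A `<=` aff y t A'.
Proof. by move=> AA' _ [x /AA' A'x <-]; exists x. Qed.

Lemma aff_setI y t A A' : t != 0 -> aff y t (A `&` A') = aff y t A `&` aff y t A'.
Proof.
by move=> t0; apply/seteqP; split=> z; rewrite /setI/= !affE.
Qed.

Lemma aff_setC y t A : t != 0 -> aff y t (~` A) = ~` aff y t A.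
Proof.
by move=> t0; apply/seteqP; split=> z; rewrite /setC/= !affE.
Qed.

Lemma box_volume_aff (y : Rn) t a b : 0 < t ->
  box_volume (y + t *: a) (y + t *: b) = t ^+ n * box_volume a b :> R.
Proof.
move=> t0; rewrite /box_volume.
rewrite [t ^+ n](_ : _ = \prod_(i < n) t); last by rewrite prodr_const card_ord.
rewrite -big_split/=.
apply: eq_bigr => i _; rewrite !mxE maxr_pMr ?(ltW t0)// mulr0 mulrBr.
by congr Num.max; ring.
Qed.

Lemma box_aff y t a b : 0 < t -> aff y t (box a b) = box (y + t *: a) (y + t *: b) :> set Rn.
Proof.
move=> t0; apply/seteqP; split=> z.
  rewrite affE ?lt0r_neq0// => + i => /(_ i); rewrite !mxE.
  by rewrite ltr_pdivlMl// ler_pdivrMl// ltrBrDl lerBlDl.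
rewrite affE ?lt0r_neq0// => + i => /(_ i); rewrite !mxE.
by rewrite ltr_pdivlMl// ler_pdivrMl// ltrBrDl lerBlDl.
Qed.

Let lebesgue_outer_aff_le y t A : 0 < t -> (lam (aff y t A) <= (t ^+ n)%:E * lam A)%E.
Proof.
move=> t0; rewrite -lee_pdivrMl ?exprn_gt0//; apply: le_ereal_inf_tmp => _ [J [a [b [AJ ->]]]].
rewrite lee_pdivrMl ?exprn_gt0//.
apply: le_trans; last first.
  apply: esumZ_le; first by rewrite exprn_ge0// ltW.
  by move=> k; rewrite lee_fin box_volume_ge0.
apply: ereal_inf_lbound; exists J, (fun k => y + t *: a k), (fun k => y + t *: b k); split.
  move=> _ [x /AJ[k Jk xk] <-]; exists k => //; rewrite -box_aff//.
  by exists x.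
by apply: eq_esum => k _; rewrite box_volume_aff// EFinM.
Qed.

Lemma lebesgue_outer_aff y t A : 0 < t -> lam (aff y t A) = ((t ^+ n)%:E * lam A)%E.
Proof.
move=> t0; apply/eqP; rewrite eq_le lebesgue_outer_aff_le//= -{1}(affK y A (lt0r_neq0 t0)).
by rewrite -lee_pdivlMl ?exprn_gt0// -exprVn lebesgue_outer_aff_le// invr_gt0.
Qed.

Lemma measurable_aff y t A : 0 < t -> meas A -> meas (aff y t A).
Proof.
move=> t0 mA; suff : lam.-caratheodory (aff y t A) by [].
have {}mA : lam.-caratheodory A by [].
move=> X; rewrite -(affVK y X (lt0r_neq0 t0)) -aff_setC ?lt0r_neq0//.
rewrite -!aff_setI ?lt0r_neq0// //; set Y := aff _ t^-1 X.
rewrite !(lebesgue_outer_aff _ _ t0).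
by rewrite (mA Y) ge0_muleDr ?outer_measure_ge0.
Qed.

(** * Measurability of boxes, open sets and closed sets *)

(** The hyperplane cuts each box of a cover into two boxes whose volumes add up exactly. The
    truncation in [box_volume] keeps this true when a piece or the box itself is empty. *)
Lemma measurable_halfspace (i : 'I_n) (c : R) : meas [set x : Rn | x 0 i <= c].
Proof.
apply: le_caratheodory_measurable => X.
set H := [set x | _]; apply: le_ereal_inf_tmp => _ [J [a [b [XJ ->]]]].
pose b' k : Rn := \row_j (if j == i then Num.min (b k 0 i) c else b k 0 j).
pose a' k : Rn := \row_j (if j == i then Num.max (a k 0 i) c else a k 0 j).
have E k : box_volume (a k) (b k) = box_volume (a k) (b' k) + box_volume (a' k) (b k).
  have D (F : 'I_n -> R) : \prod_(j < n) F j = F i * \prod_(j < n | j != i) F j.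
    by rewrite (bigD1 i).
  rewrite /box_volume !D.
  have -> : \prod_(j < n | j != i) Num.max 0 (b' k 0 j - a k 0 j) =
     \prod_(j < n | j != i) Num.max 0 (b k 0 j - a k 0 j).
    by apply: eq_bigr => j /negPf ji; rewrite mxE ji.
  have -> : \prod_(j < n | j != i) Num.max 0 (b k 0 j - a' k 0 j) =
     \prod_(j < n | j != i) Num.max 0 (b k 0 j - a k 0 j).
    by apply: eq_bigr => j /negPf ji; rewrite mxE ji.
  rewrite -mulrDl; congr (_ * _); rewrite !mxE eqxx.
  move: (a k 0 i) (b k 0 i) => u v.
  by have [?|?] := leP v c; have [?|?] := leP u c; rewrite !maxEle;
    do 3?[case: (boolP (_ <= _)); rewrite -?ltNge => ?]; lra.
under eq_esum do rewrite E EFinD.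
rewrite esumD; last 2 first.
- by move=> k _; rewrite lee_fin box_volume_ge0.
- by move=> k _; rewrite lee_fin box_volume_ge0.
apply: leeD; apply: ereal_inf_lbound.
- exists J, a, b'; split=> // x [/XJ[k Jk xk] xH]; exists k => // j.
  have /andP[ax xb] := xk j.
  by rewrite mxE; case: eqP => [ji|_]; rewrite ax //= -ji le_min xb/= ji.
- exists J, a', b; split=> // x [/XJ[k Jk xk] xH]; exists k => // j.
  have /andP[ax xb] := xk j; have cx : c < x 0 i by rewrite ltNge; apply/negP.
  by rewrite mxE; case: eqP => [ji|_]; rewrite xb andbT // -ji gt_max ax/= ji.
Qed.

Lemma measurable_box (a b : Rn) : meas (box a b).
Proof.
have -> : box a b = \bigcap_(i in [set: 'I_n])
    (~` [set x : Rn | x 0 i <= a 0 i] `&` [set x | x 0 i <= b 0 i]).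
  apply/seteqP; split=> [x xab i _|x xab i].
    by have /andP[? ?] := xab i; split => //=; apply/negP; rewrite -ltNge.
  by have [/negP ? ?] := xab i I; rewrite ltNge; apply/andP.
apply: fin_bigcap_measurable => // i _.
by apply: measurableI; [apply: measurableC|]; exact: measurable_halfspace.
Qed.

Lemma mx_norm_leP (x : Rn) (e : R) : 0 <= e ->
  reflect (forall i, `|x 0 i| <= e) (`|x| <= e).
Proof.
move=> e0; rewrite [`|x|]mx_normrE; apply: (iffP idP) => [/bigmax_leP[_ h] i|h].
  exact: (h (0, i)).
by apply/bigmax_leP; split=> // -[j i] _ /=; rewrite ord1.
Qed.

Lemma mx_norm_ltP (x : Rn) (e : R) : 0 < e ->
  reflect (forall i, `|x 0 i| < e) (`|x| < e).
Proof.
move=> e0; rewrite [`|x|]mx_normrE; apply: (iffP idP) => [/bigmax_ltP[_ h] i|h].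
  exact: (h (0, i)).
by apply/bigmax_ltP; split=> // -[j i] _ /=; rewrite ord1.
Qed.

Lemma measurable_open (U : set Rn) : open U -> meas U.
Proof.
move=> oU; pose r (q : 'rV[rat]_n) : Rn := \row_i ratr (q 0 i).
have -> : U = \bigcup_(q : 'rV[rat]_n * 'rV[rat]_n)
    [set x | box (r q.1) (r q.2) x /\ box (r q.1) (r q.2) `<=` U].
  apply/seteqP; split=> [x Ux|x [q _ [xq]]]; last exact.
  have /nbhs_ballP[e e0 xeU] : nbhs x U by exact: open_nbhs_nbhs.
  have qlt i : exists q, x 0 i - e < ratr q < x 0 i.
    have /rat_in_itvoo[q] : x 0 i - e < x 0 i by rewrite ltrBlDr ltrDl.
    by rewrite in_itv => ?; exists q.
  have qgt i : exists q, x 0 i < ratr q < x 0 i + e.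
    have /rat_in_itvoo[q] : x 0 i < x 0 i + e by rewrite ltrDl.
    by rewrite in_itv => ?; exists q.
  have /choice[q1 q1P] := qlt; have /choice[q2 q2P] := qgt.
  exists (\row_i q1 i, \row_i q2 i) => //; split=> [i|y yb].
    by rewrite !mxE; have /andP[_ ->] := q1P i; have /andP[/ltW -> _] := q2P i.
  apply: xeU; rewrite -ball_normE/=; apply/mx_norm_ltP => // i.
  have := yb i; rewrite !mxE; have /andP[? ?] := q1P i; have /andP[? ?] := q2P i.
  by rewrite ltr_norml => /andP[? ?]; apply/andP; split; lra.
apply: countable_bigcupT_measurable => //  q.
have [qU|qU] := pselect (box (r q.1) (r q.2) `<=` U).
  rewrite (_ : [set x | _] = box (r q.1) (r q.2)); first exact: measurable_box.
  by apply/seteqP; split=> x // [].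
rewrite (_ : [set x | _] = set0); first exact: measurable0.
by apply/seteqP; split=> x // [].
Qed.

Lemma measurable_closed (F : set Rn) : closed F -> meas F.
Proof. by move=> cF; rewrite -(setCK F); apply/measurableC/measurable_open/closed_openC. Qed.

Lemma lebesgue_outer_bounded (A : set Rn) : bounded_set A -> (lam A < +oo)%E.
Proof.
move=> [M [_ /(_ (M + 1))]]; rewrite ltrDl ltr01 => /(_ erefl) AM.
set m := M + 1 in AM.
pose b : Rn := const_mx (m + 1).
apply: (@le_lt_trans _ _ (box_volume (- b) b)%:E); last by rewrite ltry.
apply: ereal_inf_lbound; exists [set 0%N], (fun=> - b), (fun=> b); split.
  move=> x Ax; exists 0%N => // i; rewrite !mxE.
  have m0 : 0 <= m by exact: le_trans (AM _ Ax).
  have /(mx_norm_leP _ m0)/(_ i) : `|x| <= m by exact: AM.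
  by rewrite ler_norml => /andP[? ?]; apply/andP; split; lra.
by rewrite esum_set1// lee_fin box_volume_ge0.
Qed.

(** * Regularity of the outer measure *)

Section regularity.
(** [lo] and [hi] are the corners of the box enlarged about its centre by the factor [1 + 2 * e]; a
    nonempty box lies in the interior of its enlargement. *)
Let lo (a b : Rn) (e : R) : Rn := a - e *: (b - a).
Let hi (a b : Rn) (e : R) : Rn := b + e *: (b - a).

Lemma expr1D_le (c : R) : 1 < c -> exists2 e : R, 0 < e & (1 + 2 * e) ^+ n <= c.
Proof.
move=> c1.
have : (fun e : R => (1 + 2 * e) ^+ n) e @[e --> 0^'+] --> (1 + 2 * 0 : R) ^+ n.
  apply: cvg_at_right_filter.
  apply: (@continuous_comp _ _ _ (fun e : R => 1 + 2 * e) (fun u : R => u ^+ n)).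
    by apply: cvgD; [exact: cvg_cst|apply: cvgM; [exact: cvg_cst|exact: cvg_id]].
  exact: exprn_continuous.
rewrite mulr0 addr0 expr1n => /cvgr_lt/(_ _ c1) H.
near (0:R)^'+ => e; exists e; first by [].
by apply/ltW; near: e.
Unshelve. all: by end_near. Qed.

Let volume_enlarge (a b : Rn) e : 0 < e ->
  box_volume (lo a b e) (hi a b e) = (1 + 2 * e) ^+ n * box_volume a b.
Proof.
move=> e0; rewrite /box_volume.
rewrite [X in X * _](_ : _ = \prod_(i < n) (1 + 2 * e)); last by rewrite prodr_const card_ord.
rewrite -big_split/=; apply: eq_bigr => i _; rewrite !mxE maxr_pMr ?mulr0//.
  by congr Num.max; ring.
by rewrite addr_ge0// mulr_ge0// ltW.
Qed.

Let lohi (a b : Rn) e x i : 0 < e -> box a b x ->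
  lo a b e 0 i < x 0 i < hi a b e 0 i /\ lo a b e 0 i < a 0 i.
Proof.
move=> e0 /(_ i) /andP[ax xb]; have ab : 0 < b 0 i - a 0 i by rewrite subr_gt0 (lt_le_trans ax).
have := mulr_gt0 e0 ab; rewrite !mxE => h.
by split; [apply/andP; split|]; lra.
Qed.

Lemma outer_regular_open (A : set Rn) (e : R) : (lam A < +oo)%E -> 0 < e ->
  exists U, [/\ open U, A `<=` U & (lam U <= lam A + e%:E)%E].
Proof.
move=> Aoo e0.
have fA : lam A \is a fin_num by rewrite ge0_fin_numE// outer_measure_ge0.
have L0 : 0 <= fine (lam A) by rewrite fine_ge0// outer_measure_ge0.
set L := fine (lam A) in L0.
(* The cover below has total volume at most [L + e / 2]; an enlargement by at most this ratio keeps
   the total below [L + e]. *)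
have [|d d0 dL] := @expr1D_le ((L + e) / (L + e / 2)).
  by rewrite ltr_pdivlMr ?mul1r; lra.
have e20 : 0 < e / 2 by lra.
have [_ [J [a [b [AJ ->]]]]] := lb_ereal_inf_adherent e20 fA.
rewrite -/(lam A) -(fineK fA) -/L => /ltW sL.
pose W := \bigcup_(k in J) box (lo (a k) (b k) d) (hi (a k) (b k) d).
exists (interior W); split; first exact: open_interior.
  move=> x /AJ[k Jk xk].
  pose I i (y : Rn) := lo (a k) (b k) d 0 i < y 0 i < hi (a k) (b k) d 0 i.
  apply: (@filterS _ _ _ (fun y : Rn => forall i, I i y)).
    by move=> y ylh; exists k => // i; have /andP[-> /ltW ->] := ylh i.
  apply: (@filter_forall _ _ I (nbhs x)) => i.
  have [/andP[lx xh] _] := lohi i d0 xk.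
  have c : (fun M : Rn => M 0 i) y @[y --> x] --> x 0 i by exact: coord_continuous.
  near=> y; apply/andP; split; near: y.
    exact: (cvgr_gt _ c).
  exact: (cvgr_lt _ c).
apply: le_trans (le_outer_measure _ _ _ (@interior_subset _ W)) _.
apply: (@le_trans _ _ (\esum_(k in J) (box_volume (lo (a k) (b k) d) (hi (a k) (b k) d))%:E)).
  apply: ereal_inf_lbound.
  by exists J, (fun k => lo (a k) (b k) d), (fun k => hi (a k) (b k) d); split.
under eq_esum do rewrite volume_enlarge// EFinM.
apply: le_trans.
  apply: (@esumZ_le _ _ J _ (fun k => (box_volume (a k) (b k))%:E)).
    by rewrite exprn_ge0// addr_ge0// mulr_ge0// ltW.
  by move=> k; rewrite lee_fin box_volume_ge0.
apply: le_trans.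
  by apply: (lee_wpmul2l _ sL); rewrite lee_fin exprn_ge0// addr_ge0// mulr_ge0// ltW.
rewrite -!EFinD -EFinM lee_fin -ler_pdivlMr//; lra.
Unshelve. all: by end_near. Qed.

(** Reflection moves the closed faces of a half-open box to the opposite side, so the reflected
    boxes need not cover. Slightly enlarged boxes do, at an arbitrarily small cost in volume. *)
Let lebesgue_outer_opp_le A : (lam (-%R @` A) <= lam A)%E.
Proof.
apply: le_ereal_inf_tmp => _ [J [a [b [AJ ->]]]].
have [->|soo] := eqVneq (\esum_(k in J) (box_volume (a k) (b k))%:E)%E +oo%E; first exact: leey.
set s : \bar R := (\esum_(k in J) _)%E.
have s0 : (0 <= s)%E by apply: esum_ge0 => k _; rewrite lee_fin box_volume_ge0.
have fs : s \is a fin_num by rewrite ge0_fin_numE// ltey.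
rewrite -(fineK fs); apply/lee_addgt0Pr => e e0.
have L0 : 0 <= fine s by rewrite fine_ge0.
set L := fine s in L0 *.
have [|d d0 dL] := @expr1D_le ((L + e) / (L + e / 2)).
  by rewrite ltr_pdivlMr ?mul1r; lra.
apply: (@le_trans _ _ (\esum_(k in J) (box_volume (lo (a k) (b k) d) (hi (a k) (b k) d))%:E)).
  apply: ereal_inf_lbound.
  exists J, (fun k => - hi (a k) (b k) d), (fun k => - lo (a k) (b k) d); split.
    move=> _ [x /AJ[k Jk xk] <-]; exists k => // i.
    have [/andP[lx xh] _] := lohi i d0 xk.
    by move: lx xh; rewrite !mxE => ? ?; apply/andP; split; lra.
  apply: eq_esum => k _; congr EFin; apply: eq_bigr => i _; rewrite !mxE.
  by congr Num.max; ring.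
under eq_esum do rewrite volume_enlarge// EFinM.
apply: le_trans.
  apply: (@esumZ_le _ _ J _ (fun k => (box_volume (a k) (b k))%:E)).
    by rewrite exprn_ge0// addr_ge0// mulr_ge0// ltW.
  by move=> k; rewrite lee_fin box_volume_ge0.
rewrite -/s -(fineK fs) -/L -EFinD -EFinM lee_fin.
apply: (@le_trans _ _ ((L + e) / (L + e / 2) * L)).
  by rewrite ler_wpM2r.
have e20 : 0 < e / 2 by rewrite divr_gt0.
rewrite mulrAC ler_pdivrMr ?ltr_wpDl//.
by rewrite ler_wpM2l ?lerDl ?ltW// ltr_wpDl.
Qed.

Lemma opp_imageK A : -%R @` (-%R @` A) = A.
Proof.
by rewrite image_comp; under eq_imagel do rewrite /= opprK; rewrite image_id.
Qed.

Lemma lebesgue_outer_opp A : lam (-%R @` A) = lam A.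
Proof.
by apply/eqP; rewrite eq_le lebesgue_outer_opp_le -{1}(opp_imageK A) lebesgue_outer_opp_le.
Qed.

Lemma measurable_opp A : meas A -> meas (-%R @` A).
Proof.
move=> mA; suff : lam.-caratheodory (-%R @` A) by [].
have {}mA : lam.-caratheodory A by [].
have IE X Y : -%R @` X `&` -%R @` Y = -%R @` (X `&` Y) :> set Rn.
  apply/seteqP; split=> [_ [[x Xx <-] [y Yy /oppr_inj yx]]|_ [x [Xx Yx] <-]].
    by exists x => //; split=> //; rewrite -yx.
  by split; exists x.
have CE X : ~` (-%R @` X) = -%R @` (~` X) :> set Rn.
  apply/seteqP; split=> [x Xx|_ [x Xx <-] [y Xy /oppr_inj yx]].
    by exists (- x); rewrite ?opprK// => Xx'; apply: Xx; exists (- x); rewrite ?opprK.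
  by apply: Xx; rewrite -yx.
move=> X; have E Y : X `&` -%R @` Y = -%R @` (-%R @` X `&` Y).
  by rewrite -IE opp_imageK.
transitivity (lam (-%R @` X)); first by rewrite lebesgue_outer_opp.
by rewrite (mA (-%R @` X)) CE !E !lebesgue_outer_opp.
Qed.

(** The hull is a countable intersection of open supersets whose measures approach that of [A]. *)
Lemma measurable_hull A : (lam A < +oo)%E ->
  exists H, [/\ meas H, A `<=` H & lam H = lam A].
Proof.
move=> Aoo.
have /choice[U Uk] : forall k, exists U,
    [/\ open U, A `<=` U & (lam U <= lam A + (k.+1%:R^-1)%:E)%E].
  by move=> k; apply: outer_regular_open => //; rewrite invr_gt0.
exists (\bigcap_k U k); split.
- by apply: bigcapT_measurable => k; apply: measurable_open; have [] := Uk k.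
- by move=> x Ax k _; have [_ /(_ _ Ax)] := Uk k.
apply/eqP; rewrite eq_le; apply/andP; split; last first.
  by apply: le_outer_measure => x Ax k _; have [_ /(_ _ Ax)] := Uk k.
apply/lee_addgt0Pr => e e0.
have [k /ltW ke] := ex_invrS_lt e0.
apply: (@le_trans _ _ (lam (U k))); first by apply: le_outer_measure => x; apply.
have [_ _ /le_trans] := Uk k; apply; by rewrite leeD2l// lee_fin.
Qed.

(** Caratheodory splitting by [Z] writes the equal finite values for [H] and [A] as sums of two
    parts. Each part for [H] dominates the one for [A], so both agree. In this way a hull stands in
    for a set not known to be measurable. *)
Lemma hull_setI A H Z : meas H -> meas Z -> A `<=` H -> lam H = lam A -> (lam A < +oo)%E ->
  lam (H `&` Z) = lam (A `&` Z).
Proof.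
move=> mH mZ AH HA Aoo.
have {}mZ : lam.-caratheodory Z by [].
have AZ : (lam (A `&` Z) <= lam (H `&` Z))%E by apply: le_outer_measure; exact: setSI.
have AZC : (lam (A `&` ~` Z) <= lam (H `&` ~` Z))%E by apply: le_outer_measure; exact: setSI.
have HZoo : (lam (H `&` Z) < +oo)%E.
  by apply: (@le_lt_trans _ _ (lam H)); [apply: le_outer_measure; exact: subIsetl|rewrite HA].
have HZCoo : (lam (H `&` ~` Z) < +oo)%E.
  by apply: (@le_lt_trans _ _ (lam H)); [apply: le_outer_measure; exact: subIsetl|rewrite HA].
move: HA; rewrite (mZ H) (mZ A).
have g0 X : (0 <= lam X)%E by exact: outer_measure_ge0.
have fHZ : lam (H `&` Z) \is a fin_num by rewrite ge0_fin_numE.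
have fHZC : lam (H `&` ~` Z) \is a fin_num by rewrite ge0_fin_numE.
have fAZ : lam (A `&` Z) \is a fin_num by rewrite ge0_fin_numE// (le_lt_trans AZ).
have fAZC : lam (A `&` ~` Z) \is a fin_num by rewrite ge0_fin_numE// (le_lt_trans AZC).
move: AZ AZC; rewrite -(fineK fHZ) -(fineK fHZC) -(fineK fAZ) -(fineK fAZC).
by rewrite !lee_fin -!EFinD => ? ? [?]; congr EFin; lra.
Qed.

End regularity.

(** * Parallelotopes and single-shape differentiation *)

(* A ball of the norm [|x M|], that is a parallelotope when [M] is invertible. *)
Definition mball (M : 'M[R]_n) (c : Rn) (r : R) : set Rn := [set x | `|(x - c) *m M| <= r].

Lemma mulmx_bounded (M : 'M[R]_n) : exists2 k : R, 0 < k & forall x : Rn, `|x *m M| <= k * `|x|.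
Proof.
pose k := 1 + \sum_i \sum_j `|M i j|; exists k.
  by rewrite ltr_pwDl// sumr_ge0// => i _; rewrite sumr_ge0.
move=> x; have k0 : 0 <= k by rewrite addr_ge0// sumr_ge0// => i _; rewrite sumr_ge0.
apply/mx_norm_leP; first by rewrite mulr_ge0.
move=> j; rewrite mxE; apply: le_trans (ler_norm_sum _ _ _) _.
apply: (@le_trans _ _ (\sum_i `|M i j| * `|x|)).
  apply: ler_sum => i _; rewrite normrM mulrC ler_wpM2l//.
  by apply/mx_norm_leP.
rewrite -mulr_suml ler_wpM2r// /k -[leLHS]add0r lerD//.
apply: ler_sum => i _; rewrite (bigD1 j)//= lerDl sumr_ge0//.
Qed.

Lemma continuous_mulmxr (M : 'M[R]_n) : continuous (fun x : Rn => x *m M).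
Proof.
have [k k0 kM] := mulmx_bounded M.
move=> x A /nbhs_ballP[e e0 xA]; apply/nbhs_ballP.
exists (e / k); first by rewrite /= divr_gt0.
move=> y; rewrite -ball_normE/= => xy; apply: xA; rewrite -ball_normE/=.
by rewrite -mulmxBl (le_lt_trans (kM _))// mulrC -ltr_pdivlMr.
Qed.

Lemma closed_mball M c r : closed (mball M c r).
Proof.
have cf : continuous (fun x : Rn => `|(x - c) *m M|).
  move=> x; apply: (@continuous_comp _ _ _ (fun x => (x - c) *m M) (fun x => `|x|)).
    apply: (@continuous_comp _ _ _ (fun x => x - c) (fun x => x *m M)).
      by apply: continuousB; [move=> A; exact|exact: cst_continuous].
    exact: continuous_mulmxr.
  exact: norm_continuous.
apply: (@preimage_closed _ _ _ [set t : R | t <= r]); last exact: closed_le.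
by move=> x _; exact: cf.
Qed.

Lemma measurable_mball M c r : meas (mball M c r).
Proof. exact/measurable_closed/closed_mball. Qed.

Lemma nbhs_mball M c (r : R) : 0 < r -> nbhs c (mball M c r).
Proof.
move=> r0; have [k k0 kM] := mulmx_bounded M.
apply/nbhs_ballP; exists (r / k); first by rewrite /= divr_gt0.
move=> x; rewrite -ball_normE/= distrC => xc.
by rewrite /mball/= (le_trans (kM _))// mulrC -ler_pdivlMr// ltW.
Qed.

Lemma rat_dense c A : nbhs c A -> exists q : 'rV[rat]_n, A (\row_i ratr (q 0 i)).
Proof.
move=> /nbhs_ballP[e e0 cA].
have /choice[q qP] : forall i, exists q, c 0 i < ratr q < c 0 i + e.
  move=> i; have /rat_in_itvoo[q] : c 0 i < c 0 i + e by rewrite ltrDl.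
  by rewrite in_itv => ?; exists q.
exists (\row_i q i); apply: cA; rewrite -ball_normE/=; apply/mx_norm_ltP => // i.
by rewrite !mxE ltr_norml; have /andP[? ?] := qP i; apply/andP; split; lra.
Qed.

(** The selected balls are disjoint neighbourhoods of their centres, so rational points inside them
    enumerate the family. Only the centres in [V] have to be covered: two balls that meet, with
    [r x <= 2 * r y], have centres within [3 * r y]. *)
Lemma vitali_mball (M : 'M[R]_n) (V : set Rn) (r : Rn -> R) (rmax : R) :
  (forall x, V x -> 0 < r x <= rmax) ->
  exists D, [/\ D `<=` V, countable D, trivIset D (fun x => mball M x (r x)) &
    V `<=` \bigcup_(x in D) mball M x (3 * r x)].
Proof.
move=> r0; have [|D [DV tD DP]] := vitali_selection (B := fun x => mball M x (r x)) r0.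
  move=> x /r0/andP[rx _]; exists x; rewrite /mball/= subrr mul0mx normr0; exact: ltW.
exists D; split => //.
- have /choice[q qP] : forall x, exists q : 'rV[rat]_n,
      D x -> mball M x (r x) (\row_i ratr (q 0 i)).
    move=> x; have [Dx|nDx] := pselect (D x); last by exists 0.
    have /andP[rx _] := r0 _ (DV _ Dx).
    by have [q ?] := rat_dense (nbhs_mball M x rx); exists q.
  apply/countable_injP; exists (pickle \o q) => x y.
  rewrite !inE => Dx Dy /= /(pcan_inj pickleK) qxy.
  apply: tD => //; exists (\row_i ratr (q x 0 i)); split; first exact: qP.
  by rewrite qxy; exact: qP.
- move=> x Vx; have [y [Dy [z [zx zy]] rxy]] := DP x Vx.
  exists y => //; rewrite /mball/= in zx zy *.
  have -> : x - y = (z - y) - (z - x) by rewrite opprB [RHS]addrC addrA subrK.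
  rewrite mulmxBl (le_trans (ler_normB _ _))// (le_trans (lerD zy zx))//; lra.
Qed.

(** * Null sets and integrals of a non-negative integrable function *)

Section integ.

(** [U] is arbitrary: measurability of the disjoint [F i] lets Caratheodory's criterion split them
    off one after another. *)
Lemma lebesgue_outer_superadditive (U : set Rn) (F : nat -> set Rn) :
  (forall i, meas (F i)) -> trivIset setT F ->
  (\sum_(i <oo) lam (U `&` F i) <= lam (U `&` \bigcup_i F i))%E.
Proof.
move=> mF tF; apply: le_trans; last exact: (caratheodory_lime_le mF tF (U `&` \bigcup_i F i)).
apply: le_trans; last first.
  by apply: leeDl; exact: outer_measure_ge0.
apply: lee_nneseries => i _; first by move=> _; exact: outer_measure_ge0.
by apply: le_outer_measure => x [Ux Fx]; split=> //; split=> //; exists i.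
Qed.

Lemma negligible_lam0 (N : set Rn) : mu.-negligible N -> lam N = 0%E.
Proof.
move=> [A [mA A0 NA]]; apply/eqP; rewrite eq_le outer_measure_ge0 andbT.
by rewrite -A0; exact: le_outer_measure.
Qed.

Lemma lam0_measurable (N : set Rn) : lam N = 0%E -> meas N.
Proof.
move=> N0; apply: le_caratheodory_measurable => X.
rewrite [X in (X + _)%E](_ : _ = 0%E) ?add0e; first by apply: le_outer_measure; exact: subIsetl.
apply/eqP; rewrite eq_le outer_measure_ge0 andbT -N0.
by apply: le_outer_measure; exact: subIsetr.
Qed.

Lemma lam0_ae (P : Rn -> Prop) : lam (~` [set x | P x]) = 0%E -> {ae mu, forall x, P x}.
Proof. by move=> h; exists (~` [set x | P x]); split=> //; exact: lam0_measurable. Qed.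

Lemma ae_lam0 (P : Rn -> Prop) : {ae mu, forall x, P x} -> lam (~` [set x | P x]) = 0%E.
Proof. exact: negligible_lam0. Qed.

Lemma lam0_sub (A A' : set Rn) : A `<=` A' -> lam A' = 0%E -> lam A = 0%E.
Proof.
by move=> AA' A0; apply/eqP; rewrite eq_le outer_measure_ge0 andbT -A0 le_outer_measure.
Qed.

Lemma lam0_setU (A A' : set Rn) : lam A = 0%E -> lam A' = 0%E -> lam (A `|` A') = 0%E.
Proof.
move=> A0 A'0; apply/eqP; rewrite eq_le outer_measure_ge0 andbT.
apply: le_trans (outer_measureU2 lam _ _) _.
by rewrite -[leRHS]adde0 -{1}A0 -A'0.
Qed.

Lemma lam0_bigcup (I : countType) (F : I -> set Rn) :
  (forall i, lam (F i) = 0%E) -> lam (\bigcup_i F i) = 0%E.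
Proof.
move=> F0; pose G k := if unpickle k is Some i then F i else set0.
have FG : \bigcup_i F i `<=` \bigcup_k G k.
  by move=> x [i _ Fx]; exists (pickle i) => //; rewrite /G pickleK.
apply: lam0_sub FG _; apply/eqP; rewrite eq_le outer_measure_ge0 andbT.
apply: le_trans (outer_measure_sigma_subadditive lam G) _.
by rewrite eseries0// => k _ _; rewrite /G; case: unpickle => // ; rewrite outer_measure0.
Qed.

Definition integ (f : Rn -> R) (A : set Rn) : \bar R := (\int[mu]_(y in A) (f y)%:E)%E.

Variable f : Rn -> R.
Hypothesis intf : Lebesgue_integrable f.
Hypothesis f0 : forall x, 0 <= f x.

Local Notation mf := (measurable_int mu intf).

Lemma measurable_sublevel p : meas [set x | f x <= p].
Proof.
have := emeasurable_fun_infty_c measurableT mf p%:E.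
by rewrite setTI (_ : [set x | _] = [set x | f x <= p]).
Qed.

Lemma integ_ge0 A : (0 <= integ f A)%E.
Proof. by apply: integral_ge0 => x _; rewrite lee_fin. Qed.

Lemma integ_le A A' : meas A -> meas A' -> A `<=` A' -> (integ f A <= integ f A')%E.
Proof.
move=> mA mA' AA'; apply: ge0_subset_integral => //; first exact: measurable_funTS mf.
by move=> x _; rewrite lee_fin.
Qed.

Lemma integ_fin A : meas A -> integ f A \is a fin_num.
Proof. by move=> mA; apply: integrable_fin_num => //; exact: integrableS intf. Qed.

Lemma integ_split A F : meas A -> meas F ->
  integ f A = (integ f (A `&` F) + integ f (A `\` F))%E.
Proof.
move=> mA mF; rewrite -[in LHS](setUIDK A F) /integ ge0_integral_setU//.
- exact: measurableI.
- exact: measurableD.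
- exact: measurable_funTS mf.
- by move=> x _; rewrite lee_fin.
- by apply/eqP/seteqP; split=> // x [[_ +] [_ +]].
Qed.

Lemma integ_le_cst A p : meas A -> 0 <= p -> (forall x, A x -> f x <= p) ->
  (integ f A <= p%:E * lam A)%E.
Proof.
move=> mA p0 fp; rewrite -(@integral_cst _ _ _ mu A mA) ge0_le_integral//.
- by move=> x _; rewrite lee_fin.
- exact: measurable_funTS mf.
Qed.

Lemma integ_ge_cst A q : meas A -> 0 <= q -> (forall x, A x -> q <= f x) ->
  (q%:E * lam A <= integ f A)%E.
Proof.
move=> mA q0 fq; rewrite -(@integral_cst _ _ _ mu A mA) ge0_le_integral//.
- exact: measurable_funTS mf.
Qed.

Lemma integ_absolutely_continuous (e : R) : 0 < e -> exists2 d : R, 0 < d &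
  forall A, meas A -> (lam A < d%:E)%E -> (integ f A <= e%:E)%E.
Proof.
move=> e0; have [d [d0 dP]] := integral_normr_continuous intf e0.
exists d => // A mA Ad; have := ltW (dP A mA Ad).
rewrite -lee_fin /Rintegral; under eq_integral do rewrite ger0_norm//.
by rewrite fineK// integ_fin.
Qed.

Lemma integ_null A :
  lam A = 0%E -> integ f A = 0%E.
Proof.
move=> A0; have mA := lam0_measurable A0.
apply/eqP; rewrite eq_le integ_ge0// andbT.
apply/lee_addgt0Pr => e e0; rewrite add0e.
have [d d0 h] := integ_absolutely_continuous e0.
by apply: h mA _; rewrite A0 lte_fin.
Qed.

Lemma integ_subadditive (F : nat -> set Rn) : (forall i, meas (F i)) ->
  (integ f (\bigcup_i F i) <= \sum_(i <oo) integ f (F i))%E.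
Proof.
move=> mF; have mS i : meas (seqDU F i) by apply: measurableD => //; exact: bigsetU_measurable.
rewrite seqDU_bigcup_eq /integ ge0_integral_bigcup//.
  apply: lee_nneseries => i _; first by move=> _; exact: integ_ge0.
  by apply: integ_le => //; exact: subDsetl.
  exact: measurable_funTS mf.
by move=> x _; rewrite lee_fin.
Qed.

Lemma integ_superadditive X (F : nat -> set Rn) : meas X -> (forall i, meas (F i)) ->
  trivIset setT F ->
  (\sum_(i <oo) integ f (F i `&` X) <= integ f (\bigcup_i F i `&` X))%E.
Proof.
move=> mX mF tF; rewrite setI_bigcupl /integ ge0_integral_bigcup//.
- by move=> i; exact: measurableI.
- exact: measurable_funTS mf.
- by move=> x _; rewrite lee_fin.
- exact: trivIset_setIr.
Qed.

End integ.

Lemma lam_fin A : bounded_set A -> lam A \is a fin_num.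
Proof. by move=> bA; rewrite ge0_fin_numE ?outer_measure_ge0// lebesgue_outer_bounded. Qed.

Lemma bounded_setP A : bounded_set A <-> exists2 d : R, 0 < d & forall x, A x -> `|x| <= d.
Proof.
split=> [[M [_ /(_ (`|M| + 1))]]|[d d0 dA]].
  rewrite (le_lt_trans (ler_norm M)) ?ltrDl// => /(_ erefl) h.
  by exists (`|M| + 1) => //; rewrite ltr_wpDl.
exists d; split; first exact: num_real.
by move=> e /ltW de x /dA /le_trans; apply.
Qed.

Lemma bounded_norm_le A (d : R) : (forall x, A x -> `|x| <= d) -> bounded_set A.
Proof.
move=> Ad; apply/bounded_setP; exists (`|d| + 1); first by rewrite ltr_wpDl.
by move=> x /Ad /le_trans; apply; rewrite (le_trans (ler_norm d))// lerDl.
Qed.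

Lemma bounded_sub A A' : A `<=` A' -> bounded_set A' -> bounded_set A.
Proof. by move=> AA' /bounded_setP[d d0 dA]; apply/bounded_setP; exists d => // x /AA'/dA. Qed.

Lemma bounded_aff y t A : bounded_set A -> bounded_set (aff y t A).
Proof.
move=> /bounded_setP[d d0 dA]; apply/bounded_setP; exists (`|y| + `|t| * d + 1).
  by rewrite ltr_wpDl// addr_ge0// mulr_ge0// ltW.
move=> _ [x /dA xd <-]; rewrite (le_trans (ler_normD _ _))// -addrA lerD2l normrZ.
by rewrite (@le_trans _ _ (`|t| * d)) ?ler_wpM2l// lerDl.
Qed.

Lemma aff_mball M c y r t : 0 < t -> aff c t (mball M y r) = mball M (c + t *: y) (t * r).
Proof.
move=> t0; apply/seteqP; split=> z; rewrite affE ?lt0r_neq0// /mball/=.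
  rewrite (_ : t^-1 *: (z - c) - y = t^-1 *: (z - (c + t *: y))).
    by rewrite -scalemxAl normrZ gtr0_norm ?invr_gt0// ler_pdivrMl.
  by rewrite opprD addrA [in RHS]scalerBr scalerA mulVf ?lt0r_neq0// scale1r.
rewrite (_ : t^-1 *: (z - c) - y = t^-1 *: (z - (c + t *: y))).
  by rewrite -scalemxAl normrZ gtr0_norm ?invr_gt0// ler_pdivrMl.
by rewrite opprD addrA [in RHS]scalerBr scalerA mulVf ?lt0r_neq0// scale1r.
Qed.

Lemma mballE M c r : 0 < r -> mball M c r = aff c r (mball M 0 1).
Proof. by move=> r0; rewrite aff_mball// scaler0 addr0 mulr1. Qed.

Lemma bounded_mball M c r : M \in unitmx -> bounded_set (mball M c r).
Proof.
move=> uM; have [k k0 kM] := mulmx_bounded (invmx M).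
apply/bounded_setP; exists (k * `|r| + `|c| + 1).
  by rewrite ltr_wpDl// addr_ge0// mulr_ge0// ltW.
move=> x xc; rewrite -(subrK c x) (le_trans (ler_normD _ _))//.
rewrite -addrA lerD ?lerDl//.
have -> : `|x - c| = `|(x - c) *m M *m invmx M| by rewrite mulmxK.
by rewrite (le_trans (kM _))// ler_wpM2l ?(ltW k0)// (le_trans xc)// ler_norm.
Qed.

Definition vball M : R := fine (lam (mball M 0 1)).

Lemma vball_ge0 M : 0 <= vball M.
Proof. by rewrite fine_ge0// outer_measure_ge0. Qed.

Lemma lam_aff y t A : 0 < t -> bounded_set A -> lam (aff y t A) = (t ^+ n * fine (lam A))%:E.
Proof. by move=> t0 bA; rewrite lebesgue_outer_aff// EFinM fineK// lam_fin. Qed.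

Lemma lam_mball M c r : M \in unitmx -> 0 < r -> lam (mball M c r) = (r ^+ n * vball M)%:E.
Proof. by move=> uM r0; rewrite mballE// lam_aff//; exact: bounded_mball. Qed.

Lemma mball_sub M c c' r r' : `|(c - c') *m M| + r <= r' -> mball M c r `<=` mball M c' r'.
Proof.
move=> h x xc; rewrite /mball/= in xc *.
rewrite -(subrKA c) addrC mulmxDl (le_trans (ler_normD _ _))//.
by rewrite (le_trans _ h)// lerD2l.
Qed.

(** * One-sided Lebesgue theorem for the dilates of a single set *)

Section single_shape.

Variables (f : Rn -> R) (S : set Rn).
Hypotheses (intf : Lebesgue_integrable f) (f0 : forall x, 0 <= f x).
Hypotheses (mS : meas S) (bS : bounded_set S) (S0 : (0 < lam S)%E).

Let bad p q s d := [set x : Rn | [/\ `|x| <= d, f x <= p &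
  forall t, 0 < t < s -> (q%:E * lam (aff x t S) < integ f (aff x t S))%E]].

(** Enclose [E] in an open [U] of nearly the same measure, so that the part [X] of [U] where [f > p]
    is small. A member [x + t S] inside [U] has integral above [q] times its measure, and [f <= p]
    outside [X], so at least [(q - p)] times its measure comes from [X]. Summing over a Vitali
    family bounds [E] by a multiple of the integral of [f] over [X], which absolute continuity makes
    small. *)
Let bad_null p q s d : 0 <= p -> p < q -> 0 < s -> 0 < d -> lam (bad p q s d) = 0%E.
Proof.
move=> p0 pq s0 d0; set E := bad p q s d.
have bE : bounded_set E by apply/bounded_setP; exists d => // x [].
have [r r0 Sr] := (bounded_setP _).1 bS.
set a := fine (lam S); have fS := lam_fin bS.
have a0 : 0 < a by rewrite -lte_fin fineK.
set b := vball (1%:M : 'M[R]_n); have b0 : 0 <= b := vball_ge0 _.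
have u1 : (1%:M : 'M[R]_n) \in unitmx by exact: unitmx1.
(* Ratio of the measure of a tripled cube of radius [t * r] to [(q - p)] times that of [x + t S];
   the powers of [t] cancel. *)
pose K := (3 * r) ^+ n * b / ((q - p) * a).
have qp0 : 0 < q - p by rewrite subr_gt0.
have K0 : 0 <= K.
  by rewrite divr_ge0// ?mulr_ge0 ?exprn_ge0// ?mulr_ge0 ?ltW.
have lamaff x t : 0 < t -> lam (aff x t S) = (t ^+ n * a)%:E by move=> t0; exact: lam_aff.
suff h e : 0 < e -> (lam E <= (K * e)%:E)%E.
  apply/eqP; rewrite eq_le outer_measure_ge0 andbT; apply/lee_addgt0Pr => e e0.
  rewrite add0e; apply: le_trans (h (e / (K + 1)) _) _.
    by rewrite divr_gt0// ltr_wpDl.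
  rewrite lee_fin mulrCA ger_pMr// ler_pdivrMr ?ltr_wpDl// mul1r lerDl//.
move=> e0; pose F := [set x | f x <= p]; have mF : meas F by exact: measurable_sublevel.
have [c c0 cP] := integ_absolutely_continuous intf f0 e0.
have c20 : 0 < c / 2 by rewrite divr_gt0.
have Eoo : (lam E < +oo)%E by exact: lebesgue_outer_bounded.
have fE := lam_fin bE.
have [U [oU EU UE]] := outer_regular_open Eoo c20.
have mU := measurable_open oU.
pose X := U `\` F; have mX : meas X by exact: measurableD.
(* As [E] lies in [F], splitting [U] by [F] gives [lam E + lam X <= lam U], and [lam U] exceeds
   [lam E] by at most [c / 2]. *)
have Xc : (lam X < c%:E)%E.
  have mF' : lam.-caratheodory F by [].
  have : (lam E + lam X <= lam E + (c / 2)%:E)%E.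
    rewrite (le_trans _ UE)// (mF' U) leeD2r//.
    by apply: le_outer_measure => x Ex; split; [exact: EU|case: Ex].
  rewrite leeD2lE// => /le_lt_trans; apply; rewrite lte_fin; lra.
have /choice[t tP] : forall x, exists t, E x ->
    [/\ 0 < t, t < s, t * r <= 1 & mball 1%:M x (t * r) `<=` U].
  move=> x; have [Ex|nEx] := pselect (E x); last by exists 0.
  have /nbhs_ballP[g g0 gU] : nbhs x U by apply: open_nbhs_nbhs; split=> //; exact: EU.
  have {}g0 : 0 < g by [].
  pose g' := Num.min (g / 2) 1.
  have g'0 : 0 < g' by rewrite lt_min divr_gt0/=.
  exists (Num.min (s / 2) (g' / r)) => _.
  have hr : Num.min (s / 2) (g' / r) * r <= g' by rewrite -ler_pdivlMr// ge_min lexx orbT.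
  split.
  - by rewrite lt_min !divr_gt0.
  - by rewrite gt_min; apply/orP; left; lra.
  - by rewrite (le_trans hr)// ge_min lexx orbT.
  - move=> y; rewrite /mball/= mulmx1 => yx; apply: gU; rewrite -ball_normE/= distrC.
    apply: le_lt_trans yx _; apply: le_lt_trans hr _.
    by rewrite gt_min; apply/orP; left; lra.
have [|D [DE cD tD ED]] := @vitali_mball 1%:M E (fun x => t x * r) 1.
  by move=> x /tP[t0 _ -> _]; rewrite mulr_gt0.
have affsub x : E x -> aff x (t x) S `<=` mball 1%:M x (t x * r).
  move=> /tP[t0 _ _ _] _ [y /Sr yr <-]; rewrite /mball/= mulmx1 addrC addKr normrZ gtr0_norm//.
  by rewrite ler_pM2l.
have tB : trivIset D (fun x => aff x (t x) S).
  move=> i j Di Dj [y [yi yj]]; apply: tD => //; exists y.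
  by split; apply: affsub => //; exact: DE.
have mB x : D x -> meas (aff x (t x) S).
  by move=> /DE/tP[t0 _ _ _]; exact: measurable_aff.
apply: le_trans (le_outer_measure _ _ _ ED) _.
apply: (@le_trans _ _ (K%:E * integ f ((\bigcup_(x in D) aff x (t x) S) `&` X))%E).
  apply: (@countable_family_le _ (caratheodory_type lam) R Rn D
    (fun x => mball 1%:M x (3 * (t x * r)))
    (fun x => aff x (t x) S) lam (fun Y => integ f (Y `&` X)) K) => //.
  - by move=> x Dx; exact: measurable_mball.
  - by move=> Y; exact: outer_measure_ge0.
  - by move=> Y; exact: integ_ge0.
  - by move=> G _; exact: outer_measure_sigma_subadditive.
  - by move=> G mG tG; exact: integ_superadditive.
  move=> x Dx; have Ex := DE _ Dx; have [t0 ts _ xU] := tP _ Ex; have [_ _ /(_ (t x))] := Ex.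
  rewrite t0 ts => /(_ isT); rewrite lamaff// (integ_split intf f0 (mB _ Dx) mF).
  rewrite (_ : aff x (t x) S `\` F = aff x (t x) S `&` X); last first.
    apply/seteqP; split=> y [yS yF]; split=> //; last by case: yF.
    by split=> //; exact/xU/affsub.
  have fI : integ f (aff x (t x) S `&` X) \is a fin_num.
    by apply: integ_fin => //; apply: measurableI => //; exact: mB.
  have : (integ f (aff x (t x) S `&` F) <= p%:E * (t x ^+ n * a)%:E)%E.
    rewrite -(lamaff x)//; apply: le_trans.
      apply: (integ_le_cst intf f0 _ p0); [by apply: measurableI => //; exact: mB|by move=> y []].
    by rewrite lee_wpmul2l ?lee_fin//; apply: le_outer_measure; exact: subIsetl.
  have fJ : integ f (aff x (t x) S `&` F) \is a fin_num.
    by apply: integ_fin => //; apply: measurableI => //; exact: mB.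
  rewrite lam_mball ?mulr_gt0//.
  rewrite -(fineK fI) -(fineK fJ); set I := fine _; set J := fine _.
  rewrite -!EFinM -EFinD lee_fin lte_fin lee_fin => h1 h2.
  have h3 : (q - p) * a * t x ^+ n <= J by move: (t x ^+ n) h1 h2 => T h1 h2; lra.
  have -> : (3 * (t x * r)) ^+ n * vball (1%:M : 'M[R]_n) = K * ((q - p) * a * t x ^+ n).
    rewrite (mulrCA 3) exprMn -/b /K; move: (t x ^+ n) ((3 * r) ^+ n) => T W.
    by field; rewrite !lt0r_neq0.
  by rewrite ler_wpM2l.
apply: le_trans (_ : K%:E * e%:E <= _)%E; last by rewrite EFinM.
rewrite lee_wpmul2l ?lee_fin//; apply: le_trans (cP _ mX Xc).
apply: (integ_le intf f0) => //.
by apply: measurableI => //; exact: measurable_bigcup_countable.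
Qed.

(** The exceptional set is a countable union of sets [bad] with rational parameters. Applied to the
    indicator of a complement, the result serves as a density theorem: arbitrarily small dilates lie
    almost entirely in the given set. *)
Lemma single_shape_mean : {ae mu, forall x, forall q s, f x < q -> 0 < s ->
  exists2 t, 0 < t < s & (integ f (aff x t S) <= q%:E * lam (aff x t S))%E}.
Proof.
apply: lam0_ae.
pose N (i : rat * rat * nat * nat) := let: (p, q, k, m) := i in
  if (0 <= p) && (p < q) then bad (ratr p) (ratr q) k.+1%:R^-1 m.+1%:R else set0.
apply: (@lam0_sub _ (\bigcup_i N i)); last first.
  apply: lam0_bigcup => -[[[p q] k] m]; rewrite /N; case: ifPn => [/andP[p0 pq]|_].
    by apply: bad_null; rewrite ?ler0q ?ltr_rat ?invr_gt0 ?ltr0n.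
  exact: outer_measure0.
move=> x /= /existsNP[q /existsNP[s /not_implyP[fq /not_implyP[s0 H]]]].
have /rat_in_itvoo[p'] := fq; rewrite in_itv/= => /andP[fp pq].
have /rat_in_itvoo[q'] := pq; rewrite in_itv/= => /andP[pq' qq].
have [k ks] := ex_invrS_lt s0.
have [m mx] : exists m, `|x| <= m.+1%:R.
  by exists (Num.truncn `|x|); apply/ltW/truncnS_gt.
exists (p', q', k, m) => //=; rewrite -(ler0q R) (le_trans (f0 x) (ltW fp))/=.
rewrite -(ltr_rat R) pq'; split=> //; first exact: ltW.
move=> t /andP[t0 tk]; rewrite ltNge; apply/negP => h; apply: H; exists t.
  by rewrite t0 (lt_trans tk).
apply: le_trans h _; rewrite lee_wpmul2r ?outer_measure_ge0// lee_fin; exact: ltW.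
Qed.

End single_shape.

(** * Convex bodies *)

Lemma convex_setP (S : set Rn) (t : R) x y : convex_set (S : set (convex_lmodType Rn)) ->
  S x -> S y -> 0 <= t <= 1 -> S (t *: x + (1 - t) *: y).
Proof.
move=> cS Sx Sy /andP[t0 t1].
by have := cS x y (Itv01 t0 t1); rewrite !inE; apply.
Qed.

(** Translates by [1 / (k + 1)] times a basis vector transversal to the hyperplane are disjoint, of
    equal measure, and all lie in one bounded set. *)
Lemma lam_hyperplane0 (S : set Rn) (w : 'cV[R]_n) : meas S -> bounded_set S -> w != 0 ->
  (forall x, S x -> x *m w = 0) -> lam S = 0%E.
Proof.
move=> mS bS w0 Sw.
have [i wi] : exists i, w i 0 != 0.
  apply: contrapT => /forallNP h; move/eqP: w0; apply; apply/colP => i.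
  by rewrite mxE; apply/eqP/negPn/negP; exact: h.
pose F k := aff (k.+1%:R^-1 *: delta_mx 0 i : Rn) 1 S.
have lamF k : lam (F k) = lam S by rewrite lebesgue_outer_aff// expr1n mul1e.
have mF k : meas (F k) by exact: measurable_aff.
have tF : trivIset setT F.
  move=> k l _ _ [_ [[x Sx <-] [y Sy]]] /(congr1 (fun z => (z *m w) 0 0)) /=.
  rewrite !scale1r !mulmxDl (Sw _ Sx) (Sw _ Sy) !addr0 -!scalemxAl !mxE => /eqP.
  have -> : \sum_j (delta_mx 0 i : Rn) 0 j * w j 0 = w i 0.
    rewrite (bigD1 i)//= mxE !eqxx mul1r big1 ?addr0// => j ji.
    by rewrite mxE (negPf ji) andbF mul0r.
  rewrite -subr_eq0 -mulrBl mulf_eq0 (negPf wi) orbF subr_eq0.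
  by move=> /eqP/invr_inj/(mulrIn (oner_neq0 _))[].
have bF : bounded_set (\bigcup_k F k).
  have [d d0 dS] := (bounded_setP _).1 bS.
  apply/bounded_setP; exists (d + `|delta_mx 0 i : Rn|); first by rewrite ltr_wpDr.
  move=> _ [k _ [x Sx <-]]; rewrite scale1r addrC (le_trans (ler_normD _ _))//.
  rewrite lerD//; first exact: dS.
  rewrite normrZ ler_piMl// ger0_norm// invf_le1// ler1n//.
have := lebesgue_outer_superadditive setT mF tF.
under eq_eseriesr do rewrite setTI lamF.
rewrite setTI => h; apply/eqP; rewrite eq_le outer_measure_ge0 andbT leNgt; apply/negP => S0.
have fF := lam_fin bF; have fS := lam_fin bS.
pose N := Num.truncn (fine (lam (\bigcup_k F k)) / fine (lam S)).
have : (\sum_(0 <= k < N.+1) lam S <= lam (\bigcup_k F k))%E.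
  apply: le_trans h; apply: (@nneseries_lim_ge _ (fun=> lam S)) => *.
  exact: outer_measure_ge0.
rewrite -(fineK fS) -(fineK fF) in S0 *; rewrite lte_fin in S0.
rewrite sumEFin sumr_const_nat subn0 lee_fin -mulr_natl -ler_pdivlMr// leNgt truncnS_gt//.
Qed.

(** A finite family in [S] of maximal rank spans every point of [S], since appending a point cannot
    raise the rank. If the rank were below [n], a nonzero column of the cokernel would place [S] in
    a hyperplane and make it null. *)
Lemma convex_body_frame (S : set Rn) : meas S -> bounded_set S -> (0 < lam S)%E ->
  exists2 V : 'M[R]_n, V \in unitmx & forall i, S (row i V).
Proof.
move=> mS bS S0.
pose P (r : nat) := `[< exists m (V : 'M[R]_(m, n)), (forall i, S (row i V)) /\ \rank V = r >].
have exP : exists k, P k.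
  exists 0%N; apply/asboolP; exists 0%N, 0; split; first by case.
  by rewrite mxrank0.
have ubP k : P k -> (k <= n)%N.
  by move=> /asboolP[m [V [_ <-]]]; exact: rank_leq_col.
have [r /asboolP[m [V [VS rV]]] rmax] := ex_maxnP exP ubP.
have [fV|nfV] := boolP (row_full V).
  exists (rowsub (fullrankfun fV) V); first exact: fullrowsub_unit.
  by move=> i; rewrite row_rowsub.
have SV x : S x -> (x <= V)%MS.
  move=> Sx.
  have : P (\rank (col_mx V x)).
    apply/asboolP; exists (m + 1)%N, (col_mx V x); split=> // i.
    rewrite -(splitK i); case: (fintype.split i) => j /=; first by rewrite rowKu.
    rewrite rowKd (_ : row j x = x)//; apply/rowP => k.
    by rewrite mxE ord1.
  move=> /rmax; rewrite -rV => h.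
  have Vx : (V <= col_mx V x)%MS by rewrite -addsmxE addsmxSl.
  have := mxrank_leqif_sup Vx; rewrite (_ : \rank V = \rank (col_mx V x)); last first.
    by apply/eqP; rewrite eqn_leq h mxrankS.
  move=> [_]; rewrite eqxx => /esym; apply: submx_trans.
  by rewrite -addsmxE addsmxSr.
have : cokermx V != 0 by rewrite cokermx_eq0.
case/matrix0Pn => i [j Vij].
have := @lam_hyperplane0 S (col j (cokermx V)) mS bS.
move=> h; move: S0; rewrite h ?ltxx//.
  by apply: contraNneq Vij => /matrixP/(_ i 0); rewrite !mxE => ->.
move=> x /SV; rewrite submxE => /eqP xV.
by rewrite colE (mulmxA x (cokermx V)) xV mul0mx.
Qed.

Lemma det_bounded (d : R) : exists2 C : R, 0 <= C &
  forall V : 'M[R]_n, (forall i j, `|V i j| <= d) -> `|\det V| <= C.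
Proof.
exists (\sum_(s : 'S_n) `|d| ^+ n); first by rewrite sumr_ge0.
move=> V Vd; apply: le_trans (ler_norm_sum _ _ _) _; apply: ler_sum => s _.
rewrite normrM normrX normrN1 expr1n mul1r normr_prod.
rewrite [leRHS](_ : _ = \prod_(i < n) `|d|); last by rewrite prodr_const card_ord.
by apply: ler_prod => i _; rewrite normr_ge0 (le_trans (Vd _ _))// ler_norm.
Qed.

Lemma cramer_row (V : 'M[R]_n) (x : Rn) i : V \in unitmx ->
  (x *m invmx V) 0 i * \det V = \det (\matrix_(k < n, j < n) (if k == i then x 0 j else V k j)).
Proof.
move=> uV; rewrite [RHS](expand_det_row _ i) mxE big_distrl/=.
have dV : \det V != 0 by rewrite -unitfE -unitmxE.
apply: eq_bigr => j _; rewrite /invmx uV !mxE eqxx -mulrA; congr (_ * _).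
rewrite mulrC mulrA divff// mul1r /cofactor; congr (_ * \det _).
by apply/matrixP => k l; rewrite !mxE eq_sym (negPf (neq_lift _ _)).
Qed.

Lemma convex_average (S : set Rn) (u : nat -> Rn) (m : nat) :
  convex_set (S : set (convex_lmodType Rn)) -> (forall i, S (u i)) ->
  S (m.+1%:R^-1 *: \sum_(i < m.+1) u i).
Proof.
move=> cS Su; elim: m => [|m ih]; first by rewrite big_ord1 invr1 scale1r.
rewrite big_ord_recr/=.
set t : R := m.+1%:R / m.+2%:R.
have m2 : m.+2%:R != 0 :> R by [].
have -> : m.+2%:R^-1 *: (\sum_(i < m.+1) u i + u m.+1) =
    t *: (m.+1%:R^-1 *: \sum_(i < m.+1) u i) + (1 - t) *: u m.+1.
  rewrite scalerDr scalerA /t mulrAC divff// mul1r; congr (_ + _ *: _).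
  have e : m.+2%:R - m.+1%:R = 1 :> R by rewrite -natr1 addrC addKr.
  by rewrite -{2}(divff m2) -mulrBl e mul1r.
apply: convex_setP => //; apply/andP; split; first by rewrite divr_ge0.
by rewrite ler_pdivrMr// mul1r ler_nat.
Qed.

Hypothesis n0 : (0 < n)%N.

(* Take rows [v_i] in [S] maximising the determinant up to a factor 2: by Cramer's
   rule the coordinates of points of [S] in the frame [v_i] are at most 2, while the
   simplex with vertices 0 and [v_i] lies in [S]. *)
Lemma convex_body_shape (S : set Rn) : convex_set (S : set (convex_lmodType Rn)) ->
  S 0 -> meas S -> bounded_set S -> (0 < lam S)%E ->
  exists M c, [/\ M \in unitmx, mball M c 1 `<=` S & S `<=` mball M 0 (4 * n%:R)].
Proof.
move=> cS S0 mS bS lS; have [d d0 Sd] := (bounded_setP _).1 bS.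
have [C C0 detC] := det_bounded d.
pose T := [set `|\det V| | V in [set V : 'M[R]_n | forall i, S (row i V)]].
have TC : ubound T C.
  move=> _ [V SV <-]; apply: detC => i j.
  by have /(mx_norm_leP _ (ltW d0))/(_ j) := Sd _ (SV i); rewrite mxE.
have [V0 uV0 SV0] := convex_body_frame mS bS lS.
have T0 : 0 < sup T.
  apply: (@lt_le_trans _ _ `|\det V0|); first by rewrite normr_gt0 -unitfE -unitmxE.
  by apply: sup_ubound; [exists C|exists V0].
have T20 : 0 < sup T / 2 by rewrite divr_gt0.
have hT : has_sup T by split; [exists `|\det V0|; exists V0|exists C].
have [_ [V SV <-]] := sup_adherent T20 hT.
rewrite (_ : sup T - sup T / 2 = sup T / 2); last by lra.
move=> dV; have dV0 : 0 < `|\det V| by exact: lt_trans dV.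
have uV : V \in unitmx by rewrite unitmxE unitfE -normr_gt0.
have n2 : 2 * n%:R != 0 :> R by rewrite mulf_neq0// pnatr_eq0 -lt0n.
have n20 : 0 < 2 * n%:R :> R by rewrite mulr_gt0// ltr0n.
(* In the frame [V] this ball consists of the points whose coordinates all differ from [1 / (2 n)]
   by at most [1 / (2 n)]. They lie in [[0, 1 / n]], hence have sum at most 1. *)
exists ((2 * n%:R) *: invmx V), (const_mx (2 * n%:R)^-1 *m V); split.
- by rewrite unitmxZ ?unitmx_inv// unitfE.
- move=> x; rewrite /mball/= -scalemxAr normrZ gtr0_norm// mulmxBl mulmxK//.
  rewrite mulrC -ler_pdivlMr// mul1r.
  have xV : x = x *m invmx V *m V by rewrite mulmxKV.
  move: (x *m invmx V) xV => l ->; set c0 := (2 * n%:R)^-1 => xl.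
  have ln i : 0 <= n%:R * l 0 i <= 1.
    have /mx_norm_leP/(_ i) := xl; rewrite invr_ge0 ltW// => /(_ isT).
    rewrite !mxE ler_norml => /andP[h1 h2].
    have e : c0 * n%:R = 2^-1 :> R by rewrite /c0 invfM divfK// pnatr_eq0 -lt0n.
    have nn : 0 <= n%:R :> R by [].
    have l0 : 0 <= l 0 i by lra.
    have l1 : l 0 i <= c0 + c0 by lra.
    rewrite mulr_ge0//= (le_trans (ler_wpM2l nn l1))// mulrDr mulrC e; lra.
  (* The point is the average of the [n] points [n l_i v_i], each on the segment from 0 to [v_i].
     Indices beyond [n] give 0, which is also in [S]. *)
  pose u k := if (insub k : option 'I_n) is Some i then (n%:R * l 0 i) *: row i V else 0.
  have -> : l *m V = n.-1.+1%:R^-1 *: \sum_(i < n.-1.+1) u i.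
    rewrite prednK// mulmx_sum_row scaler_sumr; apply: eq_bigr => i _.
    by rewrite /u valK scalerA mulrA mulVf ?mul1r// pnatr_eq0 -lt0n.
  apply: convex_average => // k; rewrite /u.
  case: insub => // i.
  have := @convex_setP _ (n%:R * l 0 i) _ _ cS (SV i) S0 (ln i).
  by rewrite scaler0 addr0.
- move=> x Sx; rewrite /mball/= subr0 -scalemxAr normrZ gtr0_norm//.
  rewrite (_ : 4 * n%:R = (2 * n%:R) * 2); last by ring.
  rewrite ler_pM2l//; apply/mx_norm_leP => // i.
  rewrite -(ler_pM2r dV0) -normrM cramer_row//.
  (* Replacing row [i] by [x] gives another matrix with rows in [S], of determinant at most
     [sup T < 2 |det V|]. Coordinates are thus at most 2, and the factor [2 n] in [M] yields
     [4 n]. *)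
  apply: (@le_trans _ _ (sup T)); last by lra.
  apply: sup_ubound; first by exists C.
  eexists; last reflexivity.
  move=> k; rewrite (_ : row k _ = if k == i then x else row k V); first by case: ifP.
  by apply/rowP => j; rewrite !mxE; case: ifP => _; rewrite ?mxE.
Qed.

(** * Real-valued volumes of bounded sets *)

(** [fine] sends an infinite measure to 0, so comparisons of volumes carry boundedness
    assumptions. *)
Definition vol A : R := fine (lam A).

Lemma lamE A : bounded_set A -> lam A = (vol A)%:E.
Proof. by move=> bA; rewrite fineK// lam_fin. Qed.

Lemma vol_ge0 A : 0 <= vol A.
Proof. by rewrite fine_ge0// outer_measure_ge0. Qed.

Lemma vol_le A A' : bounded_set A' -> A `<=` A' -> vol A <= vol A'.
Proof.
move=> bA' AA'; rewrite -lee_fin -!lamE//; last exact: bounded_sub AA' bA'.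
exact: le_outer_measure.
Qed.

Lemma vol_split A Z : bounded_set A -> meas Z -> vol A = vol (A `&` Z) + vol (A `\` Z).
Proof.
move=> bA mZ; have {}mZ : lam.-caratheodory Z by [].
apply: EFin_inj; rewrite EFinD -!lamE//.
- exact: bounded_sub (@subDsetl _ _ _) bA.
- exact: bounded_sub (@subIsetl _ _ _) bA.
Qed.

Lemma bounded_setU A A' : bounded_set A -> bounded_set A' -> bounded_set (A `|` A').
Proof.
move=> /bounded_setP[d d0 dA] /bounded_setP[e e0 eA]; apply/bounded_setP.
exists (d + e); first exact: addr_gt0.
by move=> x [/dA|/eA] /le_trans; apply; rewrite ?lerDl ?lerDr ltW.
Qed.

Lemma vol_setU A A' : bounded_set A -> bounded_set A' -> vol (A `|` A') <= vol A + vol A'.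
Proof.
move=> bA bA'; rewrite -lee_fin EFinD -!lamE//; last exact: bounded_setU.
exact: outer_measureU2.
Qed.

Lemma vol_aff y (t : R) A : 0 < t -> bounded_set A -> vol (aff y t A) = t ^+ n * vol A.
Proof. by move=> t0 bA; rewrite /vol lam_aff. Qed.

Lemma vol_mball M c t : M \in unitmx -> 0 < t -> vol (mball M c t) = t ^+ n * vball M.
Proof. by move=> uM t0; rewrite /vol lam_mball. Qed.

Lemma vball1_gt0 (A : set Rn) : bounded_set A -> 0 < vol A -> 0 < vball (1%:M : 'M[R]_n).
Proof.
move=> /bounded_setP[d d0 Ad] A0.
have u1 : (1%:M : 'M[R]_n) \in unitmx by exact: unitmx1.
have : vol A <= vol (mball (1%:M : 'M[R]_n) 0 d).
  apply: vol_le; first exact: bounded_mball.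
  by move=> x /Ad; rewrite /mball/= subr0 mulmx1.
rewrite vol_mball// => /(lt_le_trans A0).
by rewrite pmulr_rgt0// exprn_gt0.
Qed.

Lemma vol_opp (A : set Rn) : vol (-%R @` A) = vol A.
Proof. by rewrite /vol lebesgue_outer_opp. Qed.

Lemma bounded_opp (A : set Rn) : bounded_set A -> bounded_set (-%R @` A).
Proof.
move=> /bounded_setP[d d0 Ad]; apply/bounded_setP; exists d => // _ [x /Ad xd <-].
by rewrite normrN.
Qed.

Lemma Lebesgue_integrable_indic A : bounded_set A -> meas A ->
  Lebesgue_integrable (\1_A : Rn -> R).
Proof.
move=> bA mA; apply/integrableP; split.
  apply/measurable_EFinP; exact: measurable_indic.
under eq_integral => x _ do rewrite /= ger0_norm ?ler0n//.
by rewrite integral_indic// setIT; exact: lebesgue_outer_bounded.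
Qed.

Lemma integ_indic A D : meas A -> meas D -> integ (\1_A : Rn -> R) D = lam (A `&` D).
Proof. by move=> mA mD; rewrite /integ integral_indic. Qed.

(** * The halo inequality *)

Section halo.

(** Abstracts the members at the origin of a homothecy invariant convex basis. *)
Definition shape_family (RR : set (set Rn)) : Prop :=
  (forall S, RR S ->
    [/\ bounded_set S, meas S, 0 < vol S, S 0 & convex_set (S : set (convex_lmodType Rn))]) /\
  (forall S t, RR S -> 0 < t -> RR (aff 0 t S)).

Variable RR : set (set Rn).
Hypothesis RRP : shape_family RR.

Let RRb S : RR S -> bounded_set S. Proof. by move=> /RRP.1[]. Qed.
Let RRm S : RR S -> meas S. Proof. by move=> /RRP.1[]. Qed.
Let RRp S : RR S -> 0 < vol S. Proof. by move=> /RRP.1[]. Qed.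
Let RR0 S : RR S -> S 0. Proof. by move=> /RRP.1[]. Qed.
Let RRc S : RR S -> convex_set (S : set (convex_lmodType Rn)). Proof. by move=> /RRP.1[]. Qed.
Let RRh S t : RR S -> 0 < t -> RR (aff 0 t S). Proof. exact: RRP.2. Qed.

(* The strict inequality makes the halo open, hence measurable. *)
Definition halo (eta s : R) (G : set Rn) : set Rn :=
  [set x | exists S, [/\ RR S, (forall y, S y -> `|y| <= s) &
    eta * vol S < vol (aff x 1 S `&` G)]].

Lemma halo_sub eta s G G' : bounded_set G' -> G `<=` G' -> halo eta s G `<=` halo eta s G'.
Proof.
move=> bG' GG' x [S [RS Ss h]]; exists S; split => //; apply: lt_le_trans h _.
apply: vol_le; last exact: setIS.
exact: bounded_sub (@subIsetr _ _ _) bG'.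
Qed.

Lemma halo_bounded eta s d G : 0 <= eta -> (forall x, G x -> `|x| <= d) ->
  forall x, halo eta s G x -> `|x| <= d + s.
Proof.
move=> eta0 dG x [S [RS Ss h]].
have [y [[z Sz zy] Gy]] : aff x 1 S `&` G !=set0.
  apply/set0P/eqP => e; move: h; rewrite e /vol outer_measure0/= ltNge.
  by rewrite mulr_ge0// vol_ge0.
have -> : x = y - z by rewrite -zy scale1r addrK.
by rewrite (le_trans (ler_normB _ _))// lerD ?dG ?Ss.
Qed.

Lemma halo_aff eta s t y G : 0 < t -> bounded_set G ->
  aff y t (halo eta s G) `<=` halo eta (t * s) (aff y t G).
Proof.
move=> t0 bG _ [x [S [RS Ss h]] <-]; exists (aff 0 t S); split; first exact: RRh.
  by move=> _ [z /Ss zs <-]; rewrite add0r normrZ gtr0_norm// ler_pM2l.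
rewrite vol_aff//; last exact: RRb.
rewrite aff_aff mul1r scaler0 addr0.
have -> : aff (y + t *: x) t S = aff y t (aff x 1 S) by rewrite aff_aff mulr1.
rewrite -aff_setI ?lt0r_neq0// vol_aff//; last exact: bounded_sub (@subIsetr _ _ _) bG.
by rewrite mulrCA ltr_pM2l// exprn_gt0.
Qed.

Lemma expr1B_lt (d : R) : 0 < d -> exists2 e : R, 0 < e < 1 & 1 - (1 - e) ^+ n < d.
Proof.
move=> d0.
have : (fun e : R => 1 - (1 - e) ^+ n) e @[e --> 0^'+] --> (1 - (1 - 0) ^+ n : R).
  apply: cvg_at_right_filter; apply: cvgB; first exact: cvg_cst.
  apply: (@continuous_comp _ _ _ (fun e : R => 1 - e) (fun u : R => u ^+ n)).
    by apply: cvgB; [exact: cvg_cst|exact: cvg_id].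
  exact: exprn_continuous.
rewrite subr0 expr1n subrr => /cvgr_lt/(_ _ d0) H.
near (0:R)^'+ => e; exists e; last by near: e.
by apply/andP; split.
Unshelve. all: by end_near. Qed.

(** Since [S] is convex and contains a parallelotope about [c], the shrunken copy [I] of [x + S]
    about [x + c] lies in [y + S] for all [y] near [x]. Passing from [x + S] to [I] loses the volume
    [(1 - (1 - e) ^+ n) * vol S], and [e] is chosen to make this less than the surplus in the strict
    inequality defining the halo. *)
Lemma open_halo eta s G : bounded_set G -> meas G -> open (halo eta s G).
Proof.
move=> bG mG; rewrite openE => x [S [RS Ss h]].
have [M [c [uM cS _]]] : exists M c,
    [/\ M \in unitmx, mball M c 1 `<=` S & S `<=` mball M 0 (4 * n%:R)].
  apply: convex_body_shape => //; [exact: RRc|exact: RR0|exact: RRm|exact: RRb|].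
  by rewrite (lamE (RRb RS)) lte_fin RRp.
set a := vol S in h; have a0 : 0 < a := RRp RS.
set g := vol _ in h.
have [|e /andP[e0 e1] ed] := @expr1B_lt ((g - eta * a) / a); first by rewrite divr_gt0// subr_gt0.
apply: filterS (nbhs_mball M x e0) => y yx; exists S; split => //.
pose I := aff (x + e *: c) (1 - e) S.
have e10 : 0 < 1 - e by rewrite subr_gt0.
have bS := RRb RS; have mS := RRm RS.
have mI : meas I by exact: measurable_aff.
have cvx u v : S u -> S v -> S ((1 - e) *: u + e *: v).
  move=> Su Sv; have := @convex_setP _ (1 - e) _ _ (RRc RS) Su Sv.
  by rewrite subKr; apply; rewrite ltW//= gerBl ltW.
have Iy : I `<=` aff y 1 S.
  move=> _ [z Sz <-]; exists ((1 - e) *: z + e *: (c + e^-1 *: (x - y))).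
    apply: cvx => //; apply: cS; rewrite /mball/= addrC addKr -scalemxAl normrZ.
    by rewrite gtr0_norm ?invr_gt0// ler_pdivrMl// mulr1 -opprB mulNmx normrN.
  rewrite scale1r scalerDr scalerA divff ?lt0r_neq0// scale1r.
  by apply/rowP => i; rewrite !mxE; ring.
have Ix : I `<=` aff x 1 S.
  move=> _ [z Sz <-]; exists ((1 - e) *: z + e *: c).
    by apply: cvx => //; apply: cS; rewrite /mball/= subrr mul0mx normr0.
  by rewrite scale1r -addrA; congr (_ + _); rewrite addrC.
have bx : bounded_set (aff x 1 S) by exact: bounded_aff.
have volI : vol I = (1 - e) ^+ n * a by rewrite vol_aff.
have volx : vol (aff x 1 S) = a by rewrite vol_aff// expr1n mul1r.
have h1 : vol (aff x 1 S `\` I) = (1 - (1 - e) ^+ n) * a.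
  have := vol_split bx mI; rewrite (setIidr Ix) volI volx => E.
  by rewrite mulrBl mul1r {1}E addrAC subrr add0r.
have h2 : g <= vol (I `&` G) + vol (aff x 1 S `\` I).
  rewrite /g (@vol_split (aff x 1 S `&` G) I)//; last exact: bounded_sub (@subIsetl _ _ _) bx.
  apply: lerD.
    apply: vol_le; first exact: bounded_sub (@subIsetr _ _ _) bG.
    by move=> z [[_ Gz] Iz].
  apply: vol_le; first exact: bounded_sub (@subDsetl _ _ _) bx.
  by move=> z [[xz _] Iz].
have h3 : vol (I `&` G) <= vol (aff y 1 S `&` G).
  by apply: vol_le; [exact: bounded_sub (@subIsetr _ _ _) bG|exact: setSI].
by rewrite ltr_pdivlMr// in ed; rewrite -/a; lra.
Qed.

Lemma measurable_halo eta s G : bounded_set G -> meas G -> meas (halo eta s G).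
Proof. by move=> bG mG; apply/measurable_open/open_halo. Qed.

(* Almost every point of [U] has balls mostly contained in [U]; put a scaled copy of
   [G] in each member of a Vitali family of such balls. *)
Lemma halo_step eta G : 0 < eta -> bounded_set G -> meas G -> 0 < vol (halo eta 1 G) ->
  exists2 th : R, 0 < th <= 1 & forall s U d, 0 < s -> meas U -> (forall x, U x -> `|x| <= d) ->
    exists A, [/\ meas A, forall x, A x -> `|x| <= d + 1,
      th * vol U <= vol (U `&` halo eta s A) &
      vol A * vol (halo eta 1 G) <= 2 * vol G * vol (U `&` halo eta s A)].
Proof.
move=> eta0 bG mG; set H := halo eta 1 G; set h := vol H => h0.
have [d0 d00 Gd0] := (bounded_setP _).1 bG.
pose r := d0 + 1; have r0 : 0 < r by rewrite addr_gt0.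
have Hr x : H x -> `|x| <= r by exact: (halo_bounded (ltW eta0) Gd0).
have Gr x : G x -> `|x| <= r by move=> /Gd0/le_trans; apply; rewrite lerDl.
have bH : bounded_set H by exact: bounded_norm_le Hr.
have mH : meas H by exact: measurable_halo.
set b := vball (1%:M : 'M[R]_n); have b0 : 0 <= b := vball_ge0 _.
have u1 : (1%:M : 'M[R]_n) \in unitmx by exact: unitmx1.
(* Volume of a tripled ball over half that of the halo of the copy of [G] in it, at a common scale.
   The later [k + 1] keeps the proportion [th] positive and at most 1. *)
pose k := (3 * r) ^+ n * b / (h / 2).
have h20 : 0 < h / 2 by rewrite divr_gt0.
have k0 : 0 <= k by rewrite divr_ge0 ?(ltW h20)// mulr_ge0// exprn_ge0// mulr_ge0// ltW.
have k1 : 0 < k + 1 by rewrite ltr_wpDl.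
exists (k + 1)^-1; first by rewrite invr_gt0 k1 invf_le1// lerDr.
move=> s U d s0 mU Ud; have bU : bounded_set U by exact: bounded_norm_le Ud.
(* [t < s'] makes the shapes of the copy's halo no larger than [s], and [t * r <= 1] keeps all balls
   within distance 1 of [U]. *)
pose s' := Num.min (Num.min s 1) r^-1.
have s'0 : 0 < s' by rewrite !lt_min s0 ltr01 invr_gt0.
pose B : set Rn := mball 1%:M 0 r.
have bB : bounded_set B by exact: bounded_mball.
have mB : meas B by exact: measurable_mball.
have affB x t : 0 < t -> aff x t B = mball 1%:M x (t * r).
  by move=> t0; rewrite aff_mball// scaler0 addr0.
have inB x t (Y : set Rn) : 0 < t -> (forall y, Y y -> `|y| <= r) ->
    aff x t Y `<=` mball 1%:M x (t * r).
  by move=> t0 Yr; rewrite -affB//; apply: aff_sub => y /Yr; rewrite /B/mball/= subr0 mulmx1.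
have volB0 : 0 < vol B.
  apply: lt_le_trans h0 _; apply: vol_le => // y /Hr.
  by rewrite /B/mball/= subr0 mulmx1.
pose W : set Rn := mball 1%:M 0 (d + 1) `\` U.
have bW : bounded_set W by apply: bounded_sub (@subDsetl _ _ _) _; exact: bounded_mball.
have mW : meas W by apply: measurableD => //; exact: measurable_mball.
(* The ball leaves [U] by at most half the volume of the scaled halo inside it, so at least half of
   that halo lies in [U]. *)
pose good x t := [/\ 0 < t, t < s' & vol (mball 1%:M x (t * r) `\` U) <= h / 2 * t ^+ n].
pose V := [set x | U x /\ exists t, good x t].
have UV : lam (U `\` V) = 0%E.
  have := single_shape_mean (Lebesgue_integrable_indic bW mW) (fun x => ler0n _ _) mB bB.
  rewrite lamE// lte_fin => /(_ volB0)/ae_lam0; apply: lam0_sub => x [Ux nVx] /=.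
  move=> /(_ (h / 2 / vol B) s').
  rewrite /indic memNset; last by case.
  move=> /(_ (divr_gt0 h20 volB0) s'0)[t /andP[t0 ts]].
  rewrite integ_indic//; last exact: measurable_aff.
  rewrite affB//; set Z := mball _ _ _.
  have bZ : bounded_set Z by exact: bounded_mball.
  have -> : W `&` Z = Z `\` U.
    apply/seteqP; split=> [y [[_ nUy] Zy]//|y [Zy nUy]]; split=> //; split=> //.
    rewrite /mball/= subr0 mulmx1; move: Zy; rewrite /Z/mball/= mulmx1 => yx.
    rewrite (_ : y = x + (y - x)); last by rewrite addrC subrK.
    apply: le_trans (ler_normD _ _) _; apply: lerD; first exact: Ud.
    apply: le_trans yx _; rewrite -ler_pdivlMr// mul1r.
    by move: ts; rewrite !lt_min => /andP[_ /ltW].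
  have volZ : vol Z = t ^+ n * vol B by rewrite /Z -affB// vol_aff.
  rewrite !lamE//; last exact: bounded_sub (@subDsetl _ _ _) bZ.
  rewrite -EFinM lee_fin volZ mulrCA divfK ?lt0r_neq0// mulrC => hh.
  by apply: nVx; split=> //; exists t.
have /choice[t tP] : forall x, exists t, V x -> good x t.
  by move=> x; have [[_ [t gt]]|nV] := pselect (V x); [exists t|exists 0].
have [|D [DV cD tD VD]] := @vitali_mball 1%:M V (fun x => t x * r) 1.
  move=> x /tP[t0 ts _]; rewrite mulr_gt0//= -ler_pdivlMr// mul1r.
  by move: ts; rewrite !lt_min => /andP[_ /ltW].
pose A := \bigcup_(x in D) aff x (t x) G.
pose HH := \bigcup_(x in D) aff x (t x) H.
have DU x : D x -> U x by move=> /DV[].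
have Dt x : D x -> good x (t x) by move=> /DV/tP.
have Dt1 x : D x -> t x <= 1.
  by move=> /Dt[_ + _]; rewrite !lt_min => /andP[/andP[_ /ltW]].
have mA : meas A by apply: measurable_bigcup_countable => // x /Dt[t0 _ _]; exact: measurable_aff.
have mballd x : D x -> mball 1%:M x (t x * r) `<=` [set y | `|y| <= d + 1].
  move=> Dx y; rewrite /mball/= mulmx1 => yx; have [t0 ts _] := Dt _ Dx.
  rewrite /= (_ : y = x + (y - x)); last by rewrite addrC subrK.
  apply: le_trans (ler_normD _ _) _; apply: lerD; first exact/Ud/DU.
  apply: le_trans yx _; rewrite -ler_pdivlMr// mul1r.
  by move: ts; rewrite !lt_min => /andP[_ /ltW].
have Ad x : A x -> `|x| <= d + 1.
  by move=> [y Dy yx]; have [t0 _ _] := Dt _ Dy; apply: (mballd _ Dy); apply: inB yx.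
have bA : bounded_set A by exact: bounded_norm_le Ad.
have HHA : HH `<=` halo eta s A.
  move=> x [y Dy Hx]; have [t0 ts _] := Dt _ Dy.
  have : halo eta (t y * 1) (aff y (t y) G) x by apply: halo_aff Hx.
  rewrite mulr1 => -[S [RS Ss hS]]; exists S; split=> //.
    move=> z /Ss /le_trans; apply; move: ts; rewrite !lt_min -andbA => /andP[/ltW//].
  apply: lt_le_trans hS _; apply: vol_le; first exact: bounded_sub (@subIsetr _ _ _) bA.
  by apply: setIS => z yz; exists y.
have tHH : trivIset D (fun x => aff x (t x) H).
  move=> x y Dx Dy [z [zx zy]]; apply: tD => //; exists z.
  have [tx0 _ _] := Dt _ Dx; have [ty0 _ _] := Dt _ Dy.
  by split; [exact: inB zx|exact: inB zy].
have mHH x : D x -> meas (aff x (t x) H) by move=> /Dt[t0 _ _]; exact: measurable_aff.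
have gain x : D x -> h / 2 * t x ^+ n <= vol (U `&` aff x (t x) H).
  move=> Dx; have [t0 _ gx] := Dt _ Dx.
  have := vol_split (bounded_aff x (t x) bH) mU; rewrite vol_aff// -/h setIC.
  have : vol (aff x (t x) H `\` U) <= vol (mball 1%:M x (t x * r) `\` U).
    apply: vol_le; last by apply: setSD; exact: inB.
    by apply: bounded_sub (@subDsetl _ _ _) _; exact: bounded_mball.
  by move: (t x ^+ n) gx => T; lra.
have bUX (X : set Rn) : bounded_set (U `&` X) by exact: bounded_sub (@subIsetl _ _ _) bU.
have VDk : vol U <= k * vol (U `&` HH).
  rewrite -lee_fin EFinM -!lamE//.
  have : (lam U <= lam V)%E.
    rewrite -(add0e (lam V)) -UV addeC -[in leLHS](setIidl (_ : U `<=` V `|` U `\` V)).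
      apply: le_trans (outer_measureU2 lam V (U `\` V)).
      by apply: le_outer_measure; exact: subIsetr.
    by move=> x Ux; have [Vx|nVx] := pselect (V x); [left|right].
  move=> /le_trans; apply; apply: le_trans (le_outer_measure _ _ _ VD) _.
  apply: (@countable_family_le _ (caratheodory_type lam) R Rn D
    (fun x => mball 1%:M x (3 * (t x * r)))
    (fun x => aff x (t x) H) lam (fun Y => lam (U `&` Y)) k) => //.
  - by move=> x Dx; exact: measurable_mball.
  - by move=> Y; exact: outer_measure_ge0.
  - by move=> Y; exact: outer_measure_ge0.
  - by move=> F _; exact: outer_measure_sigma_subadditive.
  - by move=> F mF tF; exact: lebesgue_outer_superadditive.
  move=> x Dx; have [t0 _ _] := Dt _ Dx.
  rewrite lam_mball ?mulr_gt0// lamE// -EFinM lee_fin.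
  apply: le_trans (ler_wpM2l k0 (gain _ Dx)).
  rewrite (mulrCA 3) exprMn -/b /k; move: (t x ^+ n) ((3 * r) ^+ n) => T X.
  by rewrite le_eqVlt; apply/orP; left; apply/eqP; field; rewrite lt0r_neq0.
have UHH : vol (U `&` HH) <= vol (U `&` halo eta s A).
  by apply: vol_le => //; exact: setIS.
exists A; split=> //.
  rewrite mulrC ler_pdivrMr// mulrC (le_trans VDk)// (le_trans (ler_wpM2l k0 UHH))//.
  by rewrite ler_wpM2r ?vol_ge0// lerDl.
pose c := 2 * vol G / h.
have c0 : 0 <= c by rewrite divr_ge0 ?(ltW h0)// mulr_ge0// vol_ge0.
suff : vol A <= c * vol (U `&` HH).
  move=> /(ler_wpM2r (ltW h0))/le_trans; apply.
  rewrite /c mulrAC divfK ?lt0r_neq0// ler_wpM2l// mulr_ge0// vol_ge0//.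
rewrite -lee_fin EFinM -!lamE//.
apply: (@countable_family_le _ (caratheodory_type lam) R Rn D
    (fun x => aff x (t x) G)
    (fun x => aff x (t x) H) lam (fun Y => lam (U `&` Y)) c) => //.
- by move=> x /Dt[t0 _ _]; exact: measurable_aff.
- by move=> Y; exact: outer_measure_ge0.
- by move=> Y; exact: outer_measure_ge0.
- by move=> F _; exact: outer_measure_sigma_subadditive.
- by move=> F mF tF; exact: lebesgue_outer_superadditive.
move=> x Dx; have [t0 _ _] := Dt _ Dx.
rewrite lam_aff// -/(vol G) lamE// -EFinM lee_fin.
apply: le_trans (ler_wpM2l c0 (gain _ Dx)).
rewrite /c; move: (t x ^+ n) => T.
by rewrite le_eqVlt; apply/orP; left; apply/eqP; field; rewrite lt0r_neq0.
Qed.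

Lemma halo_mono eta s s' G : s <= s' -> halo eta s G `<=` halo eta s' G.
Proof. by move=> ss' x [S [RS Ss h]]; exists S; split=> // y /Ss/le_trans; apply. Qed.

(* An infimum replaces iterating [halo_step]: the measure left uncovered shrinks by a
   fixed factor at each step, at a cost in [vol A] proportional to the gain. *)
Lemma halo_fill eta G Q d s e : 0 < eta -> bounded_set G -> meas G -> 0 < vol (halo eta 1 G) ->
  meas Q -> (forall x, Q x -> `|x| <= d) -> 0 < s -> 0 < e ->
  exists A, [/\ meas A, forall x, A x -> `|x| <= d + 1,
    vol A * vol (halo eta 1 G) <= 2 * vol G * vol Q & vol (Q `\` halo eta s A) <= e].
Proof.
move=> eta0 bG mG h0 mQ Qd s0 e0; set h := vol (halo eta 1 G) in h0 *.
have bQ : bounded_set Q by exact: bounded_norm_le Qd.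
pose adm A := [/\ meas A, forall x, A x -> `|x| <= d + 1 &
  vol A * h <= 2 * vol G * vol (Q `&` halo eta s A)].
pose E := [set vol (Q `\` halo eta s A) | A in adm].
have G2 : 0 <= 2 * vol G by rewrite mulr_ge0// vol_ge0.
have E0 : lbound E 0 by move=> _ [A _ <-]; exact: vol_ge0.
have hE : has_inf E.
  split; last by exists 0.
  exists (vol (Q `\` halo eta s set0)), set0 => //; split=> //.
  by rewrite /vol outer_measure0/= mul0r mulr_ge0// vol_ge0.
have adm_bd A : adm A -> bounded_set A by move=> [_ Ad _]; exact: bounded_norm_le Ad.
have m0 : inf E <= 0.
  rewrite leNgt; apply/negP => m0.
  have [th /andP[th0 th1] step] := halo_step eta0 bG mG h0.
  have [_ [A admA <-]] := inf_adherent (mulr_gt0 th0 m0) hE.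
  have bA := adm_bd _ admA; have [mA Ad hA] := admA.
  have mHA : meas (halo eta s A) by exact: measurable_halo.
  set U := Q `\` halo eta s A => Um.
  have mU : meas U by exact: measurableD.
  have bU : bounded_set U by exact: bounded_sub (@subDsetl _ _ _) bQ.
  have Ud x : U x -> `|x| <= d by move=> [/Qd].
  have [A' [mA' A'd gain cost]] := step s U d s0 mU Ud.
  have bA' : bounded_set A' by exact: bounded_norm_le A'd.
  have bAA : bounded_set (A `|` A') by exact: bounded_setU.
  have mHA' : meas (halo eta s A') by exact: measurable_halo.
  have hAA : halo eta s A `|` halo eta s A' `<=` halo eta s (A `|` A').
    by move=> x [|]; apply: halo_sub => //.
  have admAA : adm (A `|` A').
    split; [exact: measurableU|by move=> x [/Ad|/A'd]|].
    apply: le_trans (ler_wpM2r (ltW h0) (vol_setU bA bA')) _.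
    rewrite mulrDl; apply: le_trans (lerD hA cost) _; rewrite -mulrDr ler_wpM2l//.
    have bQAA : bounded_set (Q `&` halo eta s (A `|` A')).
      exact: bounded_sub (@subIsetl _ _ _) bQ.
    rewrite (vol_split bQAA mHA) lerD//; apply: vol_le => //.
    - exact: bounded_sub (@subIsetl _ _ _) bQAA.
    - by move=> x [Qx Hx]; split=> //; split=> //; apply: hAA; left.
    - exact: bounded_sub (@subDsetl _ _ _) bQAA.
    - by move=> x [[Qx nHx] Hx]; split=> //; split=> //; apply: hAA; right.
  (* The union is admissible, so it leaves at least [inf E]. On the other hand it leaves at most
     [(1 - th) * vol U], which is below [(1 - th) * (1 + th) * inf E < inf E]. *)
  have : inf E <= vol (U `\` halo eta s A').
    apply: le_trans (ge_inf _ _) _; [by exists 0|by exists (A `|` A')|].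
    apply: vol_le; first exact: bounded_sub (@subDsetl _ _ _) bU.
    by move=> x [Qx nHx]; split; [split=> // ?|move=> ?]; apply: nHx; apply: hAA; [left|right].
  have := vol_split bU mHA'.
  have : th * vol U <= th * (inf E + th * inf E) by rewrite ler_pM2l// ltW.
  have : 0 < th * th * inf E by rewrite !mulr_gt0.
  nra.
have [_ [A [mA Ad hA] <-]] := inf_adherent e0 hE.
move=> Ae; exists A; split=> //; last by lra.
by apply: le_trans hA _; rewrite ler_wpM2l// vol_le//; exact: subIsetl.
Qed.

Hypothesis RRne : exists S, RR S.
Hypothesis RRD : forall eta (E : set Rn), 0 < eta -> bounded_set E -> meas E ->
  lam [set x | ~ E x /\ forall s, 0 < s -> halo eta s E x] = 0%E.

(** A failure for every constant lets [halo_fill] produce sets [A k] of summable volume whose halos,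
    at scales tending to 0, fill the unit ball up to measure tending to 0. Their union occupies at
    most half the ball, yet almost every point of the ball is in its halos at all scales, against
    [RRD]. *)
Lemma halo_weak eta : 0 < eta -> exists2 C : R, 0 < C &
  forall G, bounded_set G -> meas G -> vol (halo eta 1 G) <= C * vol G.
Proof.
move=> eta0; apply: contrapT => /forall2NP nC.
(* With the factor 2 of [halo_fill], the exponent [k + 3] gives [vol (A k)] at most
   [b / 2 / 2 ^+ k.+1], and these bounds add up to [b / 2]. *)
have /choice[G GP] : forall k, exists G : set Rn,
    [/\ bounded_set G, meas G & 2 ^+ (k + 3) * vol G < vol (halo eta 1 G)].
  move=> k; have [|/existsNP[G]] := nC (2 ^+ (k + 3)); first by move=> []; rewrite exprn_gt0.
  by move=> /not_implyP[bG /not_implyP[mG /negP]]; rewrite -ltNge => ?; exists G.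
have u1 : (1%:M : 'M[R]_n) \in unitmx by exact: unitmx1.
pose Q : set Rn := mball 1%:M 0 1; set b := vol Q.
have bQ : bounded_set Q by exact: bounded_mball.
have mQ : meas Q by exact: measurable_mball.
have Q1 x : Q x -> `|x| <= 1 by rewrite /Q/mball/= subr0 mulmx1.
have b0 : 0 < b.
  have [S RS] := RRne.
  by rewrite /b /Q vol_mball// expr1n mul1r (vball1_gt0 (RRb RS) (RRp RS)).
have h0 k : 0 < vol (halo eta 1 (G k)).
  by have [_ _] := GP k; apply: le_lt_trans; rewrite mulr_ge0// vol_ge0.
have /choice[A AP] : forall k, exists A : set Rn, [/\ meas A, forall x, A x -> `|x| <= 1 + 1,
    vol A <= b / 2 / 2 ^+ k.+1 & vol (Q `\` halo eta k.+1%:R^-1 A) <= k.+1%:R^-1].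
  move=> k; have [bG mG hG] := GP k.
  have k0 : 0 < k.+1%:R^-1 :> R by rewrite invr_gt0.
  have [A [mA A2 hA hQ]] := halo_fill eta0 bG mG (h0 k) mQ Q1 k0 k0.
  exists A; split=> //; rewrite -(ler_pM2r (h0 k)); apply: le_trans hA _.
  have p2 : 0 < 2 ^+ k.+1 :> R by rewrite exprn_gt0.
  rewrite mulrAC -/b.
  rewrite [leRHS](_ : _ = b * (2 ^+ k.+1)^-1 * (vol (halo eta 1 (G k)) / 2)); last first.
    by field; rewrite lt0r_neq0.
  rewrite -mulrA mulrCA -mulrA ler_pM2l// ler_pdivlMl// ler_pdivlMr//.
  have e : 2 ^+ (k + 3) = 2 ^+ k.+1 * 4 :> R by rewrite addn3 !exprS; ring.
  move: hG; rewrite e => /ltW.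
  by move: (2 ^+ k.+1) => T; lra.
pose AA := \bigcup_k A k.
have AA2 x : AA x -> `|x| <= 1 + 1 by move=> [k _]; have [_ + _ _] := AP k; exact.
have bAA : bounded_set AA by exact: bounded_norm_le AA2.
have mAA : meas AA by apply: bigcupT_measurable => k; have [] := AP k.
have volAA : vol AA <= b / 2.
  rewrite -lee_fin -lamE//; apply: le_trans (outer_measure_sigma_subadditive lam A) _.
  apply: le_trans (epsilon_trick0 xpredT (_ : 0 <= b / 2)); last by rewrite divr_ge0// ltW.
  apply: lee_nneseries => k _; first by move=> _; exact: outer_measure_ge0.
  have [_ A2 hA _] := AP k; apply: (@le_trans _ _ (vol (A k))%:E).
    by rewrite -lamE//; exact: bounded_norm_le A2.
  by rewrite lee_fin natrX.
have : 0 < vol (Q `\` AA).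
  have : vol (Q `&` AA) <= vol AA by apply: vol_le => //; exact: subIsetr.
  have := vol_split bQ mAA; rewrite -/b; lra.
suff -> : vol (Q `\` AA) = 0 by rewrite ltxx.
rewrite /vol; suff -> : lam (Q `\` AA) = 0%E by [].
(* Points of [Q] missed by all halos from some index on. Each tail intersection lies in single
   missed sets of measure tending to 0, so summability of these measures is not at issue. *)
pose N2 := \bigcup_m \bigcap_(k in [set k | (m <= k)%N]) (Q `\` halo eta k.+1%:R^-1 (A k)).
have N20 : lam N2 = 0%E.
  apply: lam0_bigcup => m; apply/eqP; rewrite eq_le outer_measure_ge0 andbT.
  apply/lee_addgt0Pr => e e0; rewrite add0e.
  have [k ke] := ex_invrS_lt e0.
  pose j := maxn m k.
  apply: (@le_trans _ _ (lam (Q `\` halo eta j.+1%:R^-1 (A j)))).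
    by apply: le_outer_measure; apply: bigcap_inf; rewrite /= leq_maxl.
  rewrite lamE; last exact: bounded_sub (@subDsetl _ _ _) bQ.
  have [_ _ _ hj] := AP j; rewrite lee_fin (le_trans hj)// (le_trans _ (ltW ke))//.
  by rewrite lef_pV2 ?posrE// ler_nat ltnS leq_maxr.
have N1 := RRD eta0 bAA mAA.
apply: (@lam0_sub _ (N2 `|` [set x | ~ AA x /\ forall s, 0 < s -> halo eta s AA x])).
  move=> x [Qx nAx]; have [xN2|nN2] := pselect (N2 x); [by left|right; split=> // s s0].
  have [m ms] := ex_invrS_lt s0.
  have [j [mj Hj]] : exists j, (m <= j)%N /\ halo eta j.+1%:R^-1 (A j) x.
    apply: contrapT => nj; apply: nN2; exists m => // j /= mj; split=> // Hj.
    by apply: nj; exists j.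
  apply: (@halo_mono _ j.+1%:R^-1); last by apply: halo_sub Hj => // y Ay; exists j.
  by rewrite (le_trans _ (ltW ms))// lef_pV2 ?posrE// ler_nat ltnS.
apply/eqP; rewrite eq_le outer_measure_ge0 andbT.
apply: le_trans (outer_measureU2 lam _ _) _.
by rewrite -[leRHS]adde0 -{1}N20 -N1.
Qed.

End halo.

(** * Calderon-Zygmund stopping *)

Section calderon_zygmund.

(* [S] lies in [mball M 0 kap]. If [x + S] contains [w] and [t <= 1], then
   [mball M w (cz_b * t)] contains the parallelotope of radius [t] about
   [w - 4 t c], and for [y] in the latter [y + 4 t S] contains [mball M w (3 * t)];
   everything stays in [mball M x cz_T]. *)
Definition kap : R := 4 * n%:R.
Definition cz_b : R := 4 * kap + 1.
Definition cz_T : R := kap + cz_b.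
(** If [G] has measure below this multiple of [vball M], the first term forces every bad scale below
    [1 / cz_b], so that stopping occurs. The second makes the total contribution of the stopped
    balls less than [(q - p)] times the volume of [S]. *)
Definition cz_const (K p q : R) : R :=
  Num.min (cz_b ^- n / 2) ((q - p) / (2 * K * (4 * kap * cz_b) ^+ n)).

Lemma kap_ge4 : 4 <= kap.
Proof. by rewrite /kap ler_peMr// ler1n. Qed.

Lemma cz_const_gt0 K p q : 0 < K -> p < q -> 0 < cz_const K p q.
Proof.
move=> K0 pq; have k4 := kap_ge4.
have k0 : 0 < kap by lra.
have b0 : 0 < cz_b by rewrite /cz_b; lra.
rewrite lt_min; apply/andP; split.
  by rewrite divr_gt0// invr_gt0 exprn_gt0.
rewrite divr_gt0// ?subr_gt0//.
apply: mulr_gt0; first by rewrite mulr_gt0.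
apply: exprn_gt0; apply: mulr_gt0 => //; exact: mulr_gt0.
Qed.

Variables (f : Rn -> R) (S : set Rn) (M : 'M[R]_n) (c : Rn).
Hypotheses (intf : Lebesgue_integrable f) (f0 : forall x, 0 <= f x).
Hypotheses (bS : bounded_set S) (mS : meas S).
Hypotheses (uM : M \in unitmx) (cS : mball M c 1 `<=` S) (Sk : S `<=` mball M 0 kap).

Lemma vball_le_vol : vball M <= vol S.
Proof.
have -> : vball M = vol (mball M c 1) by rewrite /vol lam_mball//= expr1n mul1r.
exact: vol_le.
Qed.

Lemma vol_le_vball : vol S <= kap ^+ n * vball M.
Proof.
have k0 : 0 < kap by rewrite (lt_le_trans _ kap_ge4).
have -> : kap ^+ n * vball M = vol (mball M 0 kap) by rewrite /vol lam_mball.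
by apply: vol_le => //; exact: bounded_mball.
Qed.

Lemma center_le : `|c *m M| <= kap.
Proof.
have : S c by apply: cS; rewrite /mball/= subrr mul0mx normr0.
by move=> /Sk; rewrite /mball/= subr0.
Qed.

(* [t] is bad at [w] when [G = Q \ H] takes up a fixed part of the ball of radius
   [cz_b * t]. Almost every [w] of [G] in [x + S] is bad at small [t]; stop at a bad
   [t] with [cz_b * t] not bad. There [E] is nearby, which bounds the mean of [f]. *)
Lemma calderon_zygmund (E H Q : set Rn) (x : Rn) (K p q : R) :
  0 < vball M -> 0 < K -> 0 <= p -> p < q ->
  meas H -> (forall Z, bounded_set Z -> meas Z -> 0 < vol (H `&` Z) -> exists2 y, E y & Z y) ->
  (forall y, H y -> f y <= p) ->
  (forall y t, E y -> 0 < t <= 4 -> (integ f (aff y t S) <= (K * (t ^+ n * vol S))%:E)%E) ->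
  bounded_set Q -> meas Q -> mball M x cz_T `<=` Q ->
  (((q * vol S)%:E < integ f (aff x 1 S))%E) ->
  cz_const K p q * vball M <= vol (mball M x cz_T `&` (Q `\` H)).
Proof.
move=> B0 K0 p0 pq mH EH Hp Eavg bQ mQ xQ qS.
set be := vball M in B0 *; set k := kap; set b := cz_b; set T := cz_T; set G := Q `\` H.
have k4 : 4 <= k := kap_ge4.
have k0 : 0 < k by lra.
have bE : b = 4 * k + 1 by [].
have TE : T = k + b by [].
have b0 : 0 < b by lra.
have bT0 : 0 < T by lra.
have mG : meas G by exact: measurableD.
have bG : bounded_set G by exact: bounded_sub (@subDsetl _ _ _) bQ.
have bM w r : bounded_set (mball M w r) by exact: bounded_mball.
have mM w r : meas (mball M w r) by exact: measurable_mball.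
have bGM w r : bounded_set (mball M w r `&` G) by exact: bounded_sub (@subIsetr _ _ _) bG.
rewrite leNgt; apply/negP => small.
pose bad w t := t ^+ n * be / 2 <= vol (mball M w (b * t) `&` G).
have wT w t : mball M x k w -> t <= 1 -> mball M w (b * t) `<=` mball M x T.
  move=> xw t1; apply: mball_sub; rewrite TE lerD// -[leRHS]mulr1 ler_pM2l//.
have bad_lt w t : mball M x k w -> 0 < t <= 1 -> bad w t -> t < b^-1.
  move=> xw /andP[t0 t1] badt; rewrite ltNge; apply/negP => tb.
  have : vol (mball M w (b * t) `&` G) <= vol (mball M x T `&` G).
    by apply: vol_le => //; apply: setSI; exact: wT.
  move=> /(le_trans badt)/le_lt_trans/(_ small); rewrite ltNge => /negP; apply.
  apply: (@le_trans _ _ (b ^- n / 2 * be)).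
    by rewrite ler_pM2r// ge_min lexx.
  rewrite mulrAC ler_pM2r// ler_pM2r// -exprVn.
  by rewrite lerXn2r// nnegrE ?invr_ge0 ltW.
have good_avg w t : mball M x k w -> 0 < t <= 1 -> ~ bad w t ->
    (integ f (mball M w (3 * t)) <= (K * (4 * k) ^+ n * (t ^+ n * be))%:E)%E.
  move=> xw /andP[t0 t1] /negP; rewrite -ltNge => nbad.
  (* At a scale that is not bad, more than half of [Z] lies in [H], so [Z] contains some [y] of [E].
     The parallelotope of radius [4 t] about [y + 4 t c], inside [y + 4 t S], has its centre within
     [t] of [w] and so contains the ball of radius [3 t]. *)
  pose Z := mball M (w - (4 * t) *: c) t.
  have Zw : Z `<=` mball M w (b * t).
    apply: mball_sub; rewrite addrAC subrr add0r mulNmx normrN -scalemxAl normrZ.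
    rewrite gtr0_norm ?mulr_gt0// bE (mulrDl (4 * k)) mul1r lerD2r mulrAC ler_pM2r//.
    by rewrite ler_pM2l// center_le.
  have ZQ : Z `<=` Q by move=> y /Zw/(wT _ _ xw t1)/xQ.
  have [y Ey Zy] : exists2 y, E y & Z y.
    apply: EH; [exact: bM|exact: mM|].
    have := vol_split (bM (w - (4 * t) *: c) t) mH; rewrite -/Z setIC.
    rewrite {1}/Z vol_mball// -/be.
    have : vol (Z `\` H) <= vol (mball M w (b * t) `&` G).
      by apply: vol_le => // z [Zz nHz]; split; [exact: Zw|split=> //; exact: ZQ].
    have : 0 < t ^+ n * be by rewrite mulr_gt0// exprn_gt0.
    lra.
  have sub : mball M w (3 * t) `<=` aff y (4 * t) S.
    apply: (subset_trans _ (aff_sub cS)); rewrite aff_mball ?mulr_gt0// mulr1.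
    apply: mball_sub.
    rewrite (_ : w - (y + (4 * t) *: c) = - (y - (w - (4 * t) *: c))); last first.
      by apply/rowP => i; rewrite !mxE; ring.
    rewrite mulNmx normrN; have := Zy; rewrite /Z/mball/= => h; lra.
  have maff : meas (aff y (4 * t) S) by apply: measurable_aff => //; rewrite mulr_gt0.
  apply: le_trans (integ_le intf f0 (mM _ _) maff sub) _.
  apply: le_trans (Eavg y (4 * t) Ey _) _; first by rewrite mulr_gt0//= -[leRHS]mulr1 ler_pM2l.
  rewrite lee_fin (_ : K * ((4 * t) ^+ n * vol S) = K * 4 ^+ n * t ^+ n * vol S); last first.
    by rewrite exprMn; ring.
  rewrite (_ : _ * (t ^+ n * be) = K * 4 ^+ n * t ^+ n * (k ^+ n * be)); last first.
    by rewrite exprMn; ring.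
  by rewrite ler_wpM2l ?vol_le_vball// !mulr_ge0// ?exprn_ge0// ltW.
pose good w := exists t, [/\ 0 < t, t < b^-1, bad w t & ~ bad w (b * t)].
pose A := aff x 1 S `&` G.
have xA w : aff x 1 S w -> mball M x k w.
  by move=> [s /Sk ks <-]; move: ks; rewrite /mball/= subr0 scale1r addrC addKr.
have A_good : lam (A `\` good) = 0%E.
  have bI : bounded_set (Q `&` H) by exact: bounded_sub (@subIsetl _ _ _) bQ.
  have mI : meas (Q `&` H) by exact: measurableI.
  have := single_shape_mean (Lebesgue_integrable_indic bI mI) (fun x => ler0n _ _)
    (mM 0 1) (bM 0 1).
  rewrite lamE// lte_fin vol_mball// expr1n mul1r => /(_ B0)/ae_lam0.
  apply: lam0_sub => w [[Sw [Qw nHw]] ngood] /= /(_ 2^-1 1).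
  rewrite /indic memNset; last by case.
  rewrite invr_gt0 ltr0n => /(_ isT ltr01)[t /andP[t0 t1]].
  have xw := xA _ Sw.
  have wt1 : mball M w t `<=` mball M w (b * t).
    by apply: mball_sub; rewrite subrr mul0mx normr0 add0r ler_peMl ?ltW//; lra.
  have wtQ : mball M w t `<=` Q by move=> y /wt1/(wT _ _ xw (ltW t1))/xQ.
  rewrite -mballE// integ_indic// lamE; last exact: bounded_sub (@subIsetr _ _ _) (bM w t).
  rewrite lamE// vol_mball// -/be -EFinM lee_fin => h.
  have bad0 : bad w t.
    have := vol_split (bM w t) mH; rewrite vol_mball// -/be.
    have : vol (mball M w t `&` H) <= vol ((Q `&` H) `&` mball M w t).
      apply: vol_le => [|y [wy Hy]]; first exact: bounded_sub (@subIsetr _ _ _) (bM w t).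
      by split=> //; split=> //; exact: wtQ.
    have : vol (mball M w t `\` H) <= vol (mball M w (b * t) `&` G).
      by apply: vol_le => // z [Zz nHz]; split; [exact: wt1|split=> //; exact: wtQ].
    rewrite /bad; lra.
  apply: ngood; apply: contrapT => nst.
  (* Without a stopping scale, badness passes from [t] to [b * t] for ever, while bad scales stay at
     most 1. This is impossible since [b >= 2]. *)
  have bj j : bad w (b ^+ j * t) /\ b ^+ j * t <= 1.
    elim: j => [|j [ih ih1]]; first by rewrite expr0 mul1r (ltW t1).
    have bjt0 : 0 < b ^+ j * t by rewrite mulr_gt0// exprn_gt0.
    have lt1 : b ^+ j * t < b^-1 by apply: bad_lt ih; rewrite ?bjt0.
    rewrite exprS -mulrA; split; last by rewrite -ler_pdivlMl// mulr1 ltW.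
    by apply: contrapT => nb; apply: nst; exists (b ^+ j * t).
  have [_] := bj (Num.truncn t^-1).+1; rewrite leNgt => /negP; apply.
  rewrite -ltr_pdivrMr// mul1r (lt_trans (truncnS_gt _))//.
  apply: (@lt_le_trans _ _ (2 ^+ (Num.truncn t^-1).+1)).
    by rewrite -natrX ltr_nat ltn_expl.
  by rewrite lerXn2r// ?nnegrE//; lra.
have /choice[t tP] : forall w, exists t, good w ->
    [/\ 0 < t, t < b^-1, bad w t & ~ bad w (b * t)].
  by move=> w; have [[t gt]|ng] := pselect (good w); [exists t|exists 0].
pose W := A `&` good.
have [|D [DW cD tD WD]] := @vitali_mball M W (fun w => b * t w) 1.
  move=> w [_ /tP[t0 tb _ _]]; rewrite mulr_gt0//= -ler_pdivlMl// mulr1 ltW//.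
pose C := \bigcup_(w in D) mball M w (3 * (b * t w)).
pose BB := \bigcup_(w in D) mball M w (b * t w).
have mC : meas C by apply: measurable_bigcup_countable => // w _; exact: mM.
have mA : meas A by apply: measurableI => //; exact: measurable_aff.
pose kk := 2 * K * (4 * k * b) ^+ n.
have kk0 : 0 < kk.
  apply: mulr_gt0; first exact: mulr_gt0.
  by apply: exprn_gt0; apply: mulr_gt0 => //; exact: mulr_gt0.
have DP w : D w -> [/\ mball M x k w, 0 < t w, t w < b^-1, bad w (t w) & ~ bad w (b * t w)].
  by move=> /DW[[/xA xw _] /tP[? ? ? ?]].
(* The scale [b * t w] is not bad, which bounds the integral over the tripled ball by a multiple of
   [t w ^+ n * vball M]. The scale [t w] is bad, which bounds this power by twice the part of [G] in
   the disjoint ball of radius [b * t w]. *)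
have fC : (integ f C <= kk%:E * lam ((mball M x T `&` G) `&` BB))%E.
  apply: (@countable_family_le _ (caratheodory_type lam) R Rn D
    (fun w => mball M w (3 * (b * t w)))
    (fun w => mball M w (b * t w)) (integ f) (fun Y => lam ((mball M x T `&` G) `&` Y)) kk) => //.
  - exact: ltW.
  - by apply: (integ_null intf f0); exact: outer_measure0.
  - by move=> Y; exact: integ_ge0.
  - by move=> Y; exact: outer_measure_ge0.
  - by move=> F mF; exact: integ_subadditive.
  - by move=> F mF tF; exact: lebesgue_outer_superadditive.
  move=> w /DP[xw t0 tb badw nbad].
  have bt1 : 0 < b * t w <= 1 by rewrite mulr_gt0//= -ler_pdivlMl// mulr1 ltW.
  apply: le_trans (good_avg _ _ xw bt1 nbad) _.
  have -> : mball M x T `&` G `&` mball M w (b * t w) = mball M w (b * t w) `&` G.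
    apply/seteqP; split=> [y [[_ Gy] wy]//|y [wy Gy]]; split=> //; split=> //.
    apply: (wT w (t w)) => //; rewrite ltW// (lt_trans tb)// invf_lt1//; lra.
  rewrite lamE// -EFinM lee_fin /kk.
  have := ler_wpM2l (ltW kk0) badw; apply: le_trans.
  rewrite le_eqVlt; by apply/orP; left; apply/eqP; rewrite /kk !exprMn; field.
have bA : bounded_set A by exact: bounded_sub (@subIsetr _ _ _) bG.
have fAC : (integ f A <= integ f C)%E.
  rewrite (integ_split intf f0 mA mC) (_ : integ f (A `\` C) = 0%E) ?adde0.
    by apply: (integ_le intf f0) => //; exact: measurableI.
  apply: (integ_null intf f0); apply: lam0_sub A_good => y [Ay nCy]; split=> // gy.
  by apply: nCy; apply: WD.
have fS : (integ f (aff x 1 S) <= (p * vol S)%:E + integ f A)%E.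
  have maff : meas (aff x 1 S) by exact: measurable_aff.
  rewrite (integ_split intf f0 maff mH) leeD//.
    apply: le_trans (integ_le_cst intf f0 (measurableI _ _ maff mH) p0 _) _.
      by move=> y [_ /Hp].
    rewrite EFinM lee_wpmul2l ?lee_fin//.
    apply: (@le_trans _ _ (lam (aff x 1 S))); first by apply: le_outer_measure; exact: subIsetl.
    by rewrite lam_aff// expr1n mul1r.
  apply: (integ_le intf f0) => //; first exact: measurableD.
  move=> y [Sy nHy]; split=> //; split=> //; apply: xQ; rewrite /mball/=.
  by apply: le_trans (xA _ Sy) _; rewrite -/T TE; lra.
have kkG : (kk%:E * lam (mball M x T `&` G `&` BB) <= (kk * vol (mball M x T `&` G))%:E)%E.
  rewrite [leRHS](_ : _ = kk%:E * (vol (mball M x T `&` G))%:E)%E//.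
  by rewrite lee_wpmul2l ?lee_fin ?(ltW kk0)// -lamE//; apply: le_outer_measure; exact: subIsetl.
(* Altogether [q * vol S] is below [p * vol S] plus [kk] times the measure of [G] near [x]; by
   [small] the latter is less than [(q - p) * vball M], hence than [(q - p) * vol S]. *)
have := lt_le_trans qS (le_trans fS (leeD2l _ (le_trans fAC (le_trans fC kkG)))).
rewrite -EFinD lte_fin => h1.
have : (q - p) * be <= (q - p) * vol S by rewrite ler_wpM2l ?vball_le_vol// subr_ge0 ltW.
have : kk * vol (mball M x T `&` G) < kk * ((q - p) / kk * be).
  rewrite ltr_pM2l//; apply: lt_le_trans small _; rewrite ler_pM2r//.
  by rewrite ge_min lexx orbT.
rewrite -(mulrA (q - p)) (mulrCA kk) mulVKf ?lt0r_neq0//; lra.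
Qed.

End calderon_zygmund.

(** * Nullity of the set where the upper derivative is finite and exceeds the function *)

Section upper_null.

Variable RR : set (set Rn).
Hypothesis RRP : shape_family RR.
Hypothesis RRne : exists S, RR S.
Hypothesis RRD : forall eta (E : set Rn), 0 < eta -> bounded_set E -> meas E ->
  lam [set x | ~ E x /\ forall s, 0 < s -> halo RR eta s E x] = 0%E.
Variable f : Rn -> R.
Hypotheses (intf : Lebesgue_integrable f) (f0 : forall x, 0 <= f x).

(* A proportion of [G] is near [x], so a parallelotope around [x - a c] lies in
   the halo [G1] of [G]. As [S] need not be symmetric, returning from there to [x]
   takes the halo of the reflected set [- G1]. *)
Lemma upper_null p q K r d : 0 <= p -> p < q -> 0 < K -> 0 < r ->
  lam [set x | [/\ `|x| <= d, f x <= p,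
    forall S, RR S -> (forall y, S y -> `|y| <= r) -> (integ f (aff x 1 S) <= (K * vol S)%:E)%E &
    forall s, 0 < s -> exists S, [/\ RR S, forall y, S y -> `|y| <= s &
      ((q * vol S)%:E < integ f (aff x 1 S))%E]]] = 0%E.
Proof.
move=> p0 pq K0 r0; set E := [set x | _].
have [E0|nE0] := eqVneq (lam E) 0%E; first by [].
exfalso.
have bE : bounded_set E.
  apply/bounded_setP; exists (`|d| + 1); first by rewrite ltr_wpDl.
  by move=> x [xd _ _ _]; rewrite (le_trans xd)// (le_trans (ler_norm d))// lerDl.
have Eoo := lebesgue_outer_bounded bE.
have [H0 [mH0 EH0 lamH0]] := measurable_hull Eoo.
(* The sublevel set contains [E], so cutting by it leaves a measurable hull. *)
pose H := H0 `&` [set x | f x <= p].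
have mH : meas H by apply: measurableI => //; exact: measurable_sublevel.
have EH : E `<=` H by move=> x Ex; split; [exact: EH0|case: Ex].
have lamH : lam H = lam E.
  apply/eqP; rewrite eq_le -{1}lamH0 !le_outer_measure//; exact: subIsetl.
have hull Z : bounded_set Z -> meas Z -> 0 < vol (H `&` Z) -> exists2 y, E y & Z y.
  move=> bZ mZ; rewrite /vol (hull_setI mH mZ EH lamH Eoo) => h.
  have /set0P[y [Ey Zy]] : E `&` Z != set0.
    by apply/eqP => e; move: h; rewrite e outer_measure0 ltxx.
  by exists y.
have u1 : (1%:M : 'M[R]_n) \in unitmx by exact: unitmx1.
have b0 : 0 < vball (1%:M : 'M[R]_n).
  apply: (vball1_gt0 bE); rewrite lt_neqAle vol_ge0 andbT eq_sym.
  by apply: contraNneq nE0 => h; rewrite lamE// h.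
set b := vball (1%:M : 'M[R]_n) in b0.
have k4 : 4 <= kap by exact: kap_ge4.
(* With [a = T + 1], whenever [y] is within 1 of [x - a c] in the norm of [M], the set [y + a S]
   contains the ball of radius [T] about [x]. *)
pose k : R := kap; pose T : R := cz_T; pose a := T + 1.
have k0 : 0 < k by exact: lt_le_trans k4.
have T0 : 0 < T by rewrite /T /cz_T /cz_b -/k; lra.
have a0 : 0 < a by rewrite /a; lra.
pose c1 := cz_const K p q; have c10 : 0 < c1 by exact: cz_const_gt0.
(* The volume of [a S] is at most [k ^+ n * a ^+ n * vball M]. These thresholds therefore cost at
   most half of the guaranteed [c1 * vball M] and [vball M], which gives the strict inequalities in
   the halos. *)
pose eta1 := c1 / (k ^+ n * a ^+ n) / 2; pose eta2 := (k ^+ n * a ^+ n)^-1 / 2.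
have ka0 : 0 < k ^+ n * a ^+ n by rewrite mulr_gt0// exprn_gt0.
have eta10 : 0 < eta1 by rewrite !divr_gt0.
have eta20 : 0 < eta2 by rewrite divr_gt0// invr_gt0.
have [C1 C10 C1P] := halo_weak RRP RRne RRD eta10.
have [C2 C20 C2P] := halo_weak RRP RRne RRD eta20.
(* Chosen so that [de * (1 + C2 * C1)] is half of [2 ^- n], the share of the half ball in the
   ball. *)
pose de := 2 ^- n / (2 * (1 + C2 * C1)).
have CC0 : 0 < 1 + C2 * C1 by rewrite ltr_wpDr// mulr_ge0// ltW.
have de0 : 0 < de by rewrite divr_gt0 ?invr_gt0 ?exprn_gt0// mulr_gt0.
have [d1 d10 Ed1] := (bounded_setP _).1 bE.
pose W : set Rn := mball 1%:M 0 (d1 + 1) `\` H.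
have bW : bounded_set W by apply: bounded_sub (@subDsetl _ _ _) _; exact: bounded_mball.
have mW : meas W by apply: measurableD => //; exact: measurable_mball.
have [x0 [t0 [Ex0 t00 t01 Q0]]] : exists x0 t0, [/\ E x0, 0 < t0, t0 < 1 &
    vol (mball 1%:M x0 t0 `\` H) <= de * (t0 ^+ n * b)].
  have := single_shape_mean (Lebesgue_integrable_indic bW mW) (fun x => ler0n _ _)
    (measurable_mball 1%:M 0 1) (bounded_mball 0 1 u1).
  rewrite lamE ?lte_fin ?vol_mball// ?expr1n ?mul1r; last exact: bounded_mball.
  move=> /(_ b0)/ae_lam0; set N := ~` _ => N0.
  have /set0P[x [Ex nNx]] : E `\` N != set0.
    apply/eqP => e; move/eqP: nE0; apply; apply: lam0_sub N0 => x Ex.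
    by apply: contrapT => nNx; have : (E `\` N) x by []; rewrite e.
  have := contrapT nNx => /(_ de 1).
  have -> : (\1_W x : R) = 0.
    by rewrite /indic memNset// => -[_]; apply; exact: EH.
  move=> /(_ de0 ltr01)[t /andP[t0 t1] ht]; exists x, t; split=> //.
  have bt : bounded_set (mball (1%:M : 'M[R]_n) x t) by exact: bounded_mball.
  have mt : meas (mball (1%:M : 'M[R]_n) x t) by exact: measurable_mball.
  have bWt : bounded_set (W `&` mball 1%:M x t) by exact: bounded_sub (@subIsetl _ _ _) bW.
  move: ht; rewrite -!mballE// integ_indic// (lamE bt) vol_mball// -/b lamE//.
  rewrite -EFinM lee_fin; apply: le_trans; apply: vol_le => //.
  move=> y [yx nHy]; split=> //; split=> //; move: yx; rewrite /mball/= !mulmx1 subr0 => yx.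
  rewrite (_ : y = x + (y - x)); last by rewrite addrC subrK.
  by rewrite (le_trans (ler_normD _ _))// lerD ?Ed1// (le_trans yx)// ltW.
pose Q : set Rn := mball 1%:M x0 t0; pose Q' : set Rn := mball 1%:M x0 (t0 / 2).
have bQ : bounded_set Q by exact: bounded_mball.
have mQ : meas Q by exact: measurable_mball.
have t20 : 0 < t0 / 2 by rewrite divr_gt0.
have Q'Q : Q' `<=` Q by apply: mball_sub; rewrite subrr mul0mx normr0 add0r; lra.
pose G := Q `\` H.
have bG : bounded_set G by exact: bounded_sub (@subDsetl _ _ _) bQ.
have mG : meas G by exact: measurableD.
pose G1 := halo RR eta1 1 G.
have mG1 : meas G1 by exact: measurable_halo.
have bhalo eta X : 0 < eta -> bounded_set X -> bounded_set (halo RR eta 1 X).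
  move=> e0 /bounded_setP[dX dX0 XdX]; apply/bounded_setP; exists (dX + 1); first exact: addr_gt0.
  by move=> x; apply: halo_bounded XdX _; exact: ltW.
have bG1 : bounded_set G1 by exact: bhalo.
pose G2 := -%R @` G1.
have mG2 : meas G2 by exact: measurable_opp.
have bG2 : bounded_set G2 by exact: bounded_opp.
have affa y (S : set Rn) : aff y 1 (aff 0 a S) = aff y a S.
  by rewrite aff_aff scaler0 addr0 mul1r.
have key x : E x -> Q' x -> halo RR eta2 1 G2 (- x).
  (* The three bounds keep the parallelotope of radius [T] about [x] inside [Q], the dilates [t S]
     with [t <= 4] below the size [r] where means are controlled, and [a S] below size 1. *)
  move=> Ex Q'x; pose s := Num.min (t0 / (4 * T)) (Num.min (r / 4) a^-1).
  have s0 : 0 < s by rewrite !lt_min invr_gt0 !divr_gt0 ?mulr_gt0.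
  have sT : 2 * s * T <= t0 / 2.
    have : s <= t0 / (4 * T) by rewrite ge_min lexx.
    rewrite ler_pdivlMr ?mulr_gt0//; lra.
  have sr : 4 * s <= r.
    have : s <= r / 4 by rewrite !ge_min lexx orbT.
    lra.
  have sa : a * s <= 1.
    by rewrite mulrC -ler_pdivlMr// mul1r !ge_min lexx !orbT.
  have [_ _ Eavg /(_ s s0)[S [RS Ss qS]]] := Ex.
  have [bS mS S0 S00 cvS] := RRP.1 _ RS.
  have [M [c [uM cS Sk]]] : exists M c,
      [/\ M \in unitmx, mball M c 1 `<=` S & S `<=` mball M 0 (4 * n%:R)].
    by apply: convex_body_shape => //; rewrite lamE.
  have Sbe : vol S <= k ^+ n * vball M by exact: vol_le_vball.
  have B0 : 0 < vball M.
    by have := lt_le_trans S0 Sbe; rewrite pmulr_rgt0// exprn_gt0.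
  have xTQ : mball M x T `<=` Q.
    move=> y yx; rewrite /Q/mball/= mulmx1; rewrite /mball/= in yx.
    (* A vector of norm at most 1 with respect to [M] is the difference of two points of [S], namely
       of a point of the inscribed parallelotope and its centre [c]. Both have norm at most [s]. *)
    have ux : `|T^-1 *: (y - x)| <= 2 * s.
      have -> : T^-1 *: (y - x) = (c + T^-1 *: (y - x)) - c by rewrite addrAC subrr add0r.
      rewrite mulr_natl mulr2n (le_trans (ler_normB _ _))// lerD//; apply/Ss/cS; rewrite /mball/=.
        rewrite addrAC subrr add0r -scalemxAl normrZ gtr0_norm ?invr_gt0//.
        by rewrite ler_pdivrMl// mulr1.
      by rewrite subrr mul0mx normr0.
    have yxt : `|y - x| <= t0 / 2.
      apply: le_trans sT; move: ux; rewrite normrZ gtr0_norm ?invr_gt0// ler_pdivrMl//.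
      by rewrite mulrC.
    move: Q'x; rewrite /Q'/mball/= mulmx1 => xx0.
    rewrite (_ : y - x0 = (y - x) + (x - x0)); last by rewrite subrKA.
    by rewrite (le_trans (ler_normD _ _))// [leRHS]splitr lerD.
  have cz : c1 * vball M <= vol (mball M x T `&` G).
    apply: (calderon_zygmund intf f0 bS mS uM cS Sk B0 K0 p0 pq mH hull _ _ bQ mQ xTQ qS).
      by move=> y [].
    move=> y t [_ _ Eavgy _] /andP[t1 t4].
    have := Eavgy (aff 0 t S) (RRP.2 _ _ RS t1).
    rewrite aff_aff scaler0 addr0 mul1r vol_aff//; apply => _ [z /Ss zs <-].
    rewrite add0r normrZ gtr0_norm// (le_trans _ sr)// ler_pM// ltW//.
  have RS' : RR (aff 0 a S) by exact: RRP.2.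
  have S'1 y : aff 0 a S y -> `|y| <= 1.
    by move=> [z /Ss zs <-]; rewrite add0r normrZ gtr0_norm// (le_trans _ sa)// ler_pM2l.
  have vS' : vol (aff 0 a S) <= k ^+ n * a ^+ n * vball M.
    by rewrite vol_aff// (mulrC (k ^+ n)) -mulrA ler_pM2l ?exprn_gt0//.
  have affM y : mball M (y + a *: c) a `<=` aff y a S.
    by rewrite -[X in mball _ _ X]mulr1 -aff_mball//; exact: aff_sub.
  have G1P : mball M (x - a *: c) 1 `<=` G1.
    move=> y yx; exists (aff 0 a S); split=> //; rewrite affa.
    apply: (@lt_le_trans _ _ (c1 * vball M)).
      apply: le_lt_trans (ler_wpM2l (ltW eta10) vS') _.
      rewrite /eta1 mulrA (_ : _ / 2 * (k ^+ n * a ^+ n) = c1 / 2); last first.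
        by rewrite mulrAC divfK ?lt0r_neq0.
      by rewrite ltr_pM2r//; lra.
    apply: le_trans cz _; apply: vol_le; first exact: bounded_sub (@subIsetr _ _ _) bG.
    apply: setSI; apply: subset_trans (affM y); apply: mball_sub.
    move: yx; rewrite /mball/= => yx.
    rewrite -lerBrDr (_ : a - T = 1); last by rewrite /a addrAC subrr add0r.
    rewrite (_ : x - _ = - (y - (x - a *: c))); last by apply/rowP => i; rewrite !mxE; ring.
    by rewrite mulNmx normrN.
  exists (aff 0 a S); split=> //; rewrite affa.
  apply: (@lt_le_trans _ _ (vball M)).
    apply: le_lt_trans (ler_wpM2l (ltW eta20) vS') _.
    rewrite /eta2 mulrA (_ : (k ^+ n * a ^+ n)^-1 / 2 * (k ^+ n * a ^+ n) = 2^-1).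
      by rewrite gtr_pMl// invf_lt1// ltr1n.
    by rewrite mulrAC mulVf ?lt0r_neq0// mul1r.
  have -> : vball M = vol (mball M (- x + a *: c) 1) by rewrite vol_mball// expr1n mul1r.
  apply: vol_le; first exact: bounded_sub (@subIsetr _ _ _) bG2.
  move=> z zx; split.
    apply: affM; move: z zx; apply: mball_sub; rewrite subrr mul0mx normr0 add0r /a.
    by rewrite lerDr ltW.
  exists (- z); last by rewrite opprK.
  apply: G1P; move: zx; rewrite /mball/= => zx.
  rewrite (_ : - z - _ = - (z - (- x + a *: c))); last by apply/rowP => i; rewrite !mxE; ring.
  by rewrite mulNmx normrN.
have mQ' : meas Q' by exact: measurable_mball.
have bQ' : bounded_set Q' by exact: bounded_mball.
have volE : vol (E `&` Q') <= C2 * (C1 * vol G).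
  rewrite -vol_opp; apply: (@le_trans _ _ (vol (halo RR eta2 1 G2))).
    by apply: vol_le; [exact: bhalo|move=> _ [x [Ex Q'x] <-]; exact: key].
  apply: le_trans (C2P _ bG2 mG2) _; rewrite ler_pM2l// vol_opp.
  exact: C1P.
have volH : vol (E `&` Q') = vol (H `&` Q') by rewrite /vol (hull_setI mH mQ' EH lamH Eoo).
(* The half ball has volume [2 ^- n * X], yet its parts inside and outside [H] have volumes at most
   [C2 * C1 * de * X] and [de * X], which together are only half of that. *)
have := vol_split bQ' mH; rewrite setIC -volH vol_mball// -/b expr_div_n.
have : vol (Q' `\` H) <= vol G by apply: vol_le => //; exact: setSD.
set X := t0 ^+ n * b in Q0 *; have X0 : 0 < X by rewrite mulr_gt0// exprn_gt0.
have -> : t0 ^+ n / 2 ^+ n * b = 2 ^- n * X by rewrite mulrAC mulrC.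
have dE : de * (1 + C2 * C1) = 2 ^- n / 2.
  by rewrite /de invfM mulrA divfK ?lt0r_neq0.
have : C2 * (C1 * vol G) <= C2 * (C1 * (de * X)) by rewrite !ler_pM2l.
have : 0 < 2 ^- n * X by rewrite mulr_gt0// invr_gt0 exprn_gt0.
have : C2 * (C1 * (de * X)) + de * X = 2 ^- n / 2 * X by rewrite -dE; ring.
rewrite -/(vol G) in Q0; rewrite -/G in Q0.
move: (2 ^- n) => Y; lra.
Qed.

End upper_null.

(** * Differentiation bases *)

Variable B : Rn -> set (set Rn).
Hypothesis hB : differentiation_basis B.

Let Bb x S : B x S -> bounded_set S. Proof. by move=> /(hB x).1[]. Qed.
Let Bm x S : B x S -> meas S. Proof. by move=> /(hB x).1[]. Qed.
Let Bx x S : B x S -> S x. Proof. by move=> /(hB x).1[]. Qed.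
Let Bp x S : B x S -> 0 < vol S.
Proof. by move=> /(hB x).1[bS _ S0 _]; rewrite -lte_fin -lamE. Qed.

Lemma meanE f x S : B x S -> mean f S = (((vol S)^-1)%:E * integ f S)%E.
Proof.
move=> BS; rewrite /mean; congr (_ * _)%E.
have -> : mu S = (vol S)%:E by exact: lamE (Bb BS).
by rewrite inver gt_eqF// (Bp BS).
Qed.

Lemma mean_leP f x S (q : R) : B x S -> (mean f S <= q%:E)%E = (integ f S <= (q * vol S)%:E)%E.
Proof. by move=> BS; rewrite (meanE f BS) lee_pdivrMl ?(Bp BS)// -EFinM mulrC. Qed.

Lemma mean_geP f x S (q : R) : B x S -> (q%:E <= mean f S)%E = ((q * vol S)%:E <= integ f S)%E.
Proof. by move=> BS; rewrite (meanE f BS) lee_pdivlMl ?(Bp BS)// -EFinM mulrC. Qed.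

Lemma mean_ge0 f S : (forall x, 0 <= f x) -> (0 <= mean f S)%E.
Proof.
move=> f0; rewrite /mean mule_ge0//; last exact: integ_ge0.
by rewrite inve_ge0; exact: outer_measure_ge0.
Qed.

Lemma lower_ge0 f x : (forall x, 0 <= f x) -> (0 <= lower_derivative B f x)%E.
Proof.
move=> f0.
apply: (@le_trans _ _ (ereal_inf
    [set mean f S | S in [set S | B x S /\ (diam S < 1%:E)%E]])); last first.
  by apply: ereal_sup_ubound; exists 1 => //=.
by apply: le_ereal_inf_tmp => _ [S _ <-]; exact: mean_ge0.
Qed.

(* Means of indicators lie in [0, 1], so infinite derivatives are excluded. *)
Lemma weak_Besicovitch_density : weak_Besicovitch B -> density_basis B.
Proof.
move=> hw E bE mE; have := hw _ (Lebesgue_integrable_indic bE mE) (fun x => ler0n _ _).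
move=> /ae_lam0 h; apply: lam0_ae; apply: lam0_sub h => x; apply: contra_not => -[hl hu].
split; apply: contrapT.
- move=> /hu u; have : (upper_derivative B \1_E x <= 1)%E; last by rewrite u.
  apply: (@le_trans _ _ (ereal_sup
      [set mean \1_E S | S in [set S | B x S /\ (diam S < 1%:E)%E]])).
    by apply: ereal_inf_lbound; exists 1 => //=.
  apply: ge_ereal_sup => _ [S [BS _] <-].
  rewrite (mean_leP _ _ BS) mul1r integ_indic//; last exact: Bm BS.
  by rewrite -lamE; [apply: le_outer_measure; exact: subIsetr|exact: Bb BS].
- by move=> /hl l; have := lower_ge0 x (fun x => ler0n R (x \in E)); rewrite -/(\1_E) l.
Qed.

Lemma norm_le_euclidean (x : Rn) : `|x| <= euclidean_norm x.
Proof.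
apply/mx_norm_leP; first exact: sqrtr_ge0.
move=> i; rewrite -sqrtr_sqr ler_sqrt; last by rewrite sumr_ge0// => j _; rewrite sqr_ge0.
by rewrite (bigD1 i)//= lerDl sumr_ge0// => j _; rewrite sqr_ge0.
Qed.

Lemma euclidean_le_norm (x : Rn) : euclidean_norm x <= n%:R * `|x|.
Proof.
have nx : 0 <= n%:R * `|x| by rewrite mulr_ge0.
rewrite -[leRHS]ger0_norm// -sqrtr_sqr ler_sqrt ?sqr_ge0// exprMn.
apply: (@le_trans _ _ (\sum_(i < n) `|x| ^+ 2)).
  apply: ler_sum => i _; rewrite -real_normK ?num_real// lerXn2r ?nnegrE//.
  by apply/mx_norm_leP.
by rewrite sumr_const card_ord -[leLHS]mulr_natl ler_wpM2r ?sqr_ge0// expr2 ler_peMr ?ler1n//.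
Qed.

Lemma diam_le (S : set Rn) x (s : R) : (forall y, S y -> `|y| <= s) ->
  (diam (aff x 1 S) <= (n%:R * (2 * s))%:E)%E.
Proof.
move=> Ss; apply: ge_ereal_sup => _ [[_ _] [[y Sy <-] [z Sz <-]] <-] /=.
rewrite lee_fin !scale1r opprD addrACA subrr add0r (le_trans (euclidean_le_norm _))//.
by rewrite ler_wpM2l// mulr_natl mulr2n (le_trans (ler_normB _ _))// lerD// Ss.
Qed.

Lemma diam_ge (S : set Rn) x y : S x -> S y -> (`|y - x|%:E <= diam S)%E.
Proof.
move=> Sx Sy; apply: le_trans (_ : (euclidean_norm (y - x))%:E <= _)%E.
  by rewrite lee_fin norm_le_euclidean.
by apply: ereal_sup_ubound; exists (y, x).
Qed.

(** * Reduction of an invariant convex basis to its members at the origin *)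

Hypothesis hhom : homothecy_invariant B.

Lemma homothecy_aff (a : Rn) t (S : set Rn) : homothecy a t @` S = aff (a - t *: a) t S.
Proof.
by apply: eq_imagel => x _; rewrite /homothecy scalerBr addrA addrAC.
Qed.

(** A homothecy of ratio 1 is the identity, so translations arise by composition: dilate by [2 * t]
    about 0, then by [1 / 2] about the centre [a] that brings the base point to [y]. *)
Lemma basis_aff x y t S : B x S -> 0 < t -> B y (aff (y - t *: x) t S).
Proof.
move=> BS t0; have t20 : 0 < 2 * t by rewrite mulr_gt0.
have := hhom 0 t20 BS; rewrite homothecy_aff scaler0 subrr /homothecy add0r subr0 => h1.
have h20 : 0 < 2^-1 :> R by rewrite invr_gt0.
pose a := 2 *: (y - t *: x).
have := hhom a h20 h1; rewrite homothecy_aff aff_aff scaler0 addr0 mulKf// /homothecy.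
have -> : a - 2^-1 *: a = y - t *: x.
  by rewrite /a scalerA mulVf// scale1r scaler_nat mulr2n addrK.
have -> : a + 2^-1 *: ((2 * t) *: x - a) = y.
  rewrite scalerBr scalerA mulKf// addrCA /a scalerA mulVf// scale1r.
  by rewrite scaler_nat mulr2n addrK addrC subrK.
by [].
Qed.

Let RR := B 0.

Lemma basis_at x S : RR S -> B x (aff x 1 S).
Proof. by move=> RS; have := basis_aff x RS ltr01; rewrite scaler0 subr0. Qed.

Lemma basis_at_inv x S : B x S -> exists2 S', RR S' & S = aff x 1 S'.
Proof.
move=> BS; exists (aff (- x) 1 S); last by rewrite aff_aff scale1r subrr mulr1 aff01.
by have := basis_aff 0 BS ltr01; rewrite scale1r sub0r.
Qed.

Hypothesis hconv : convex_basis B.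

Lemma basis_shape_family : shape_family RR.
Proof.
split=> [S RS|S t RS t0].
  by split; [exact: Bb RS|exact: Bm RS|exact: Bp RS|exact: Bx RS|exact: hconv RS].
by have := basis_aff 0 RS t0; rewrite scaler0 subr0.
Qed.

Hypothesis hD : density_basis B.

Lemma basis_nonempty : exists S, RR S.
Proof. by have [_ [S [BS _]]] := hB 0; exists (S 0%N); exact: BS. Qed.

Lemma small_diam (d : R) : 0 < d -> exists2 s : R, 0 < s &
  forall x S, RR S -> (forall y, S y -> `|y| <= s) -> (diam (aff x 1 S) < d%:E)%E.
Proof.
move=> d0; exists (d / 2 / (2 * n%:R)); first by rewrite !divr_gt0// mulr_gt0// ltr0n.
move=> x S RS Ss; apply: (le_lt_trans (diam_le x Ss)); rewrite lte_fin.
rewrite mulrCA mulrA mulrCA divff ?mulf_neq0 ?pnatr_eq0 -?lt0n// mulr1.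
by rewrite ltr_pdivrMr// ltr_pMr// ltr1n.
Qed.

Lemma small_member (s : R) : 0 < s -> exists2 S, RR S & forall y, S y -> `|y| <= s.
Proof.
move=> s0; have [S RS] := basis_nonempty; have [d d0 Sd] := (bounded_setP _).1 (Bb RS).
exists (aff 0 (s / d) S); first by apply: basis_shape_family.2 => //; rewrite divr_gt0.
move=> _ [y /Sd yd <-]; rewrite add0r normrZ gtr0_norm ?divr_gt0//.
by rewrite mulrAC ler_pdivrMr// ler_pM2l.
Qed.

(** The form in which the halo arguments use the density property. At almost every point outside [E]
    the upper derivative of the indicator is 0, whereas membership in the halos at all scales forces
    it to be at least [eta]. *)
Lemma basis_density eta (E : set Rn) : 0 < eta -> bounded_set E -> meas E ->
  lam [set x | ~ E x /\ forall s, 0 < s -> halo RR eta s E x] = 0%E.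
Proof.
move=> eta0 bE mE; apply: lam0_sub (ae_lam0 (hD bE mE)) => x [nEx hx] /= [+ _].
rewrite /indic memNset// => u.
have : (upper_derivative B \1_E x < eta%:E)%E by rewrite u lte_fin.
move=> /ereal_inf_lt[_ [d d0 <-] sup_lt].
have [s s0 sd] := small_diam d0.
have [S [RS Ss h]] := hx s s0.
have BS := basis_at x RS.
have : (mean \1_E (aff x 1 S) < eta%:E)%E.
  apply: (le_lt_trans _ sup_lt); apply: ereal_sup_ubound; exists (aff x 1 S) => //.
  by split=> //; exact: sd.
apply/negP; rewrite -leNgt (mean_geP _ _ BS) integ_indic//; last exact: Bm BS.
rewrite setIC lamE; last exact: bounded_sub (@subIsetr _ _ _) bE.
by rewrite lee_fin vol_aff ?expr1n ?mul1r ?ltW//; exact: Bb RS.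
Qed.

(** For any two scales, a member of diameter below both has a mean lying between the corresponding
    infimum and supremum. *)
Lemma lower_le_upper f x : (lower_derivative B f x <= upper_derivative B f x)%E.
Proof.
apply: ge_ereal_sup => _ [d d0 <-]; apply: le_ereal_inf_tmp => _ [e e0 <-].
have de0 : 0 < Num.min d e by rewrite lt_min d0 e0.
have [s s0 sP] := small_diam de0.
have [S RS Ss] := small_member s0.
have BS := basis_at x RS.
have [Sd Se] : (diam (aff x 1 S) < d%:E)%E /\ (diam (aff x 1 S) < e%:E)%E.
  by have := sP x S RS Ss; rewrite EFin_min lt_min => /andP[].
apply: (@le_trans _ _ (mean f (aff x 1 S))).
  by apply: ereal_inf_lbound; exists (aff x 1 S).
by apply: ereal_sup_ubound; exists (aff x 1 S).
Qed.

(** * Almost everywhere inequalities for the lower and upper derivatives *)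

Section integrable.
Variable f : Rn -> R.
Hypotheses (intf : Lebesgue_integrable f) (f0 : forall x, 0 <= f x).

Lemma lower_ge : lam (~` [set x | ((f x)%:E <= lower_derivative B f x)%E]) = 0%E.
Proof.
(* Superlevel sets are cut by balls because the density property concerns bounded sets. *)
pose E (q : rat) (N : nat) := [set x | ratr q <= f x] `&` mball (1%:M : 'M[R]_n) 0 N%:R.
have mE q N : meas (E q N).
  apply: measurableI; last exact: measurable_mball.
  have mf := measurable_int mu intf.
  have := emeasurable_fun_c_infty measurableT mf (ratr q)%:E.
  by rewrite setTI.
have bE q N : bounded_set (E q N).
  by apply: bounded_sub (@subIsetr _ _ _) _; exact: bounded_mball (unitmx1 _ _).
pose NN (i : rat * nat) := let A := E i.1 i.2 in
  ~` [set x | upper_derivative B \1_A x = (\1_A x)%:E /\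
              lower_derivative B \1_A x = (\1_A x)%:E].
apply: (@lam0_sub _ (\bigcup_i NN i)); last first.
  by apply: lam0_bigcup => i; apply: ae_lam0; exact: hD.
move=> x /= /negP; rewrite -ltNge => lf.
have lf0 := lower_ge0 x f0.
have fl : lower_derivative B f x \is a fin_num by rewrite ge0_fin_numE// (lt_trans lf)// ltry.
move: lf lf0; rewrite -(fineK fl) lte_fin lee_fin; set l := fine _ => lf lf0.
have /rat_in_itvoo[p] := lf; rewrite in_itv/= => /andP[lp pf].
have /rat_in_itvoo[q] := pf; rewrite in_itv/= => /andP[pq qf].
have p0 : 0 < ratr p :> R by exact: le_lt_trans lp.
have q0 : 0 < ratr q :> R by exact: lt_trans pq.
exists (q, (Num.truncn `|x|).+1) => // -[_].
set A := E _ _.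
have Ax : A x.
  split; first exact: ltW.
  by rewrite /mball/= subr0 mulmx1 ltW// truncnS_gt.
rewrite /indic mem_set//= => l1.
(* At [x] the set [A] has lower density 1, so small members meet [A] in a proportion above [p / q].
   As [f >= q] on [A], their means are at least [p]. *)
have : ((ratr p / ratr q)%:E < lower_derivative B \1_A x)%E.
  by rewrite l1 lte_fin ltr_pdivrMr// mul1r.
move=> /ereal_sup_gt[_ [d d0 <-] inf_gt].
have : ((ratr p)%:E <= lower_derivative B f x)%E.
  apply: (@le_trans _ _ (ereal_inf
      [set mean f S | S in [set S | B x S /\ (diam S < d%:E)%E]])); last first.
    by apply: ereal_sup_ubound; exists d.
  apply: le_ereal_inf_tmp => _ [S [BS Sd] <-].
  have : ((ratr p / ratr q)%:E < mean \1_A S)%E.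
    by apply: lt_le_trans inf_gt _; apply: ereal_inf_lbound; exists S.
  move=> /ltW; rewrite (mean_geP _ _ BS) (mean_geP _ _ BS) integ_indic; [|exact: mE|exact: Bm BS].
  have bAS : bounded_set (A `&` S) by exact: bounded_sub (@subIsetr _ _ _) (Bb BS).
  have mAS : meas (A `&` S) by apply: measurableI; [exact: mE|exact: Bm BS].
  rewrite lamE// lee_fin => h.
  apply: (@le_trans _ _ ((ratr q)%:E * lam (A `&` S))%E); last first.
    apply: le_trans (integ_le intf f0 mAS (Bm BS) (@subIsetr _ _ _)).
    by apply: (integ_ge_cst intf) => //; [exact: ltW|move=> y [[]]].
  by rewrite lamE// -EFinM lee_fin -ler_pdivrMl// mulrA (mulrC _^-1).
by rewrite -(fineK fl) -/l lee_fin leNgt lp.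
Qed.

(** The dilates of one fixed shape translated to [x] are members at [x], so their means already
    bound the infima from above. *)
Lemma lower_le : lam (~` [set x | (lower_derivative B f x <= (f x)%:E)%E]) = 0%E.
Proof.
have [S RS] := basis_nonempty; have [bS mS S0 _ _] := basis_shape_family.1 _ RS.
have lS : (0 < lam S)%E by rewrite lamE.
apply: lam0_sub (ae_lam0 (single_shape_mean intf f0 mS bS lS)) => x nle /= hx; apply: nle.
apply/lee_addgt0Pr => e e0; rewrite -EFinD.
apply: ge_ereal_sup => _ [d d0 <-].
have [s s0 sP] := small_diam d0.
have [d1 d10 Sd1] := (bounded_setP _).1 bS.
have fe : f x < f x + e by rewrite ltrDl.
have [t /andP[t0 ts] ht] := hx _ (s / d1) fe (divr_gt0 s0 d10).
have RtS : RR (aff 0 t S) by exact: basis_shape_family.2.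
have E : aff x t S = aff x 1 (aff 0 t S) by rewrite aff_aff scaler0 addr0 mul1r.
have BS : B x (aff x t S) by rewrite E; exact: basis_at.
have Sd : (diam (aff x t S) < d%:E)%E.
  rewrite E; apply: sP => // _ [y /Sd1 yd <-]; rewrite add0r normrZ gtr0_norm//.
  apply: le_trans (_ : t * d1 <= _); first by rewrite ler_pM2l.
  by rewrite -ler_pdivlMr// ltW.
apply: (@le_trans _ _ (mean f (aff x t S))).
  by apply: ereal_inf_lbound; exists (aff x t S).
by rewrite (mean_leP _ _ BS) EFinM -lamE//; exact: Bb BS.
Qed.

(** Finiteness of the upper derivative bounds the means by some [k + 1] at all sizes below some
    [1 / (m + 1)]. With rational [p < q] between [f x] and the upper derivative, this splits the
    exceptional set into countably many sets covered by [upper_null]. *)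
Lemma upper_le : lam (~` [set x | (upper_derivative B f x <= (f x)%:E)%E \/
  upper_derivative B f x = +oo%E]) = 0%E.
Proof.
pose E (i : rat * rat * nat * nat * nat) := let: (p, q, k, m, N) := i in
  if (0 <= p) && (p < q) then
  [set x | [/\ `|x| <= N%:R, f x <= ratr p,
    forall S, RR S -> (forall y, S y -> `|y| <= m.+1%:R^-1) ->
      (integ f (aff x 1 S) <= (k.+1%:R * vol S)%:E)%E &
    forall s, 0 < s -> exists S, [/\ RR S, forall y, S y -> `|y| <= s &
      ((ratr q * vol S)%:E < integ f (aff x 1 S))%E]]] else set0.
apply: (@lam0_sub _ (\bigcup_i E i)); last first.
  apply: lam0_bigcup => -[[[[p q] k] m] N]; rewrite /E; case: ifPn => [/andP[p0 pq]|_].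
    apply: (upper_null basis_shape_family basis_nonempty basis_density intf f0).
    - by rewrite ler0q.
    - by rewrite ltr_rat.
    - by rewrite ltr0n.
    - by rewrite invr_gt0 ltr0n.
  exact: outer_measure0.
move=> x /= /not_orP[/negP]; rewrite -ltNge => fu uoo.
have u0 : (0 <= upper_derivative B f x)%E by rewrite ltW// (le_lt_trans _ fu)// lee_fin.
have fin_u : upper_derivative B f x \is a fin_num by rewrite ge0_fin_numE// ltey; apply/eqP.
move: fu; rewrite -(fineK fin_u) lte_fin; set u := fine _ => fu.
have uE : upper_derivative B f x = u%:E by rewrite fineK.
have /rat_in_itvoo[p] := fu; rewrite in_itv/= => /andP[fp pu].
have /rat_in_itvoo[q] := pu; rewrite in_itv/= => /andP[pq qu].
pose k := Num.truncn u.
have : (upper_derivative B f x < k.+1%:R%:E)%E by rewrite uE lte_fin truncnS_gt.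
move=> /ereal_inf_lt[_ [d d0 <-] sup_lt].
have [r r0 rP] := small_diam d0.
have [m mr] := ex_invrS_lt r0.
exists (p, q, k, m, (Num.truncn `|x|).+1) => //=.
rewrite -(ler0q R) (le_trans (f0 x) (ltW fp))/= -(ltr_rat R) pq; split.
- by rewrite ltW// truncnS_gt.
- exact: ltW.
- move=> S RS Sm; have BS := basis_at x RS.
  have Sd : (diam (aff x 1 S) < d%:E)%E.
    by apply: rP => // y /Sm/le_trans; apply; exact: ltW.
  have : (mean f (aff x 1 S) < k.+1%:R%:E)%E.
    by apply: (le_lt_trans _ sup_lt); apply: ereal_sup_ubound; exists (aff x 1 S).
  by move=> /ltW; rewrite (mean_leP _ _ BS) vol_aff ?expr1n ?mul1r//; exact: Bb RS.
- move=> s s0.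
  have : ((ratr q)%:E < ereal_sup [set mean f S | S in [set S | B x S /\ (diam S < s%:E)%E]])%E.
    apply: (@lt_le_trans _ _ (upper_derivative B f x)); first by rewrite uE lte_fin.
    by apply: ereal_inf_lbound; exists s.
  move=> /ereal_sup_gt[_ [S [BS Ss] <-] qS].
  have [S' RS' E'] := basis_at_inv BS.
  exists S'; split=> //.
    move=> y S'y; have Sy : S (x + y) by rewrite E'; exists y => //; rewrite scale1r.
    have := diam_ge (Bx BS) Sy; rewrite addrAC subrr add0r => h.
    by rewrite -lee_fin ltW// (le_lt_trans h).
  have volE : vol S = vol S' by rewrite E' vol_aff ?expr1n ?mul1r//; exact: Bb RS'.
  rewrite ltNge -volE -E'; apply/negP.
  by rewrite -(mean_leP _ _ BS) leNgt qS.
Qed.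

End integrable.

(** The lower derivative equals [f] almost everywhere, which settles the first implication. It also
    bounds the upper derivative below by [f], so [upper_le] leaves only equality or [+oo]. *)
Lemma density_weak_Besicovitch : weak_Besicovitch B.
Proof.
move=> f intf f0; apply: lam0_ae.
apply: lam0_sub (lam0_setU (lower_ge intf f0) (lam0_setU (lower_le intf f0) (upper_le intf f0))).
move=> x; apply: contraPP => /not_orP[/contrapT/= h1 /not_orP[/contrapT/= h2 /contrapT/= h3]].
have lE : lower_derivative B f x = (f x)%:E by apply/eqP; rewrite eq_le h1 h2.
apply; split=> //; case: h3 => // u1 nu; exfalso; apply: nu.
by apply/eqP; rewrite eq_le u1 (le_trans h1)//; exact: lower_le_upper.
Qed.

End differentiation.

Theorem theorem4 (R : realType) (n : nat) (hn : (2 <= n)%N)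
    (B : 'rV[R]_n -> set (set 'rV[R]_n))
    (hB : differentiation_basis B)
    (hhom : homothecy_invariant B) (hconv : convex_basis B) :
  weak_Besicovitch B <-> density_basis B.
Proof.
have n0 : (0 < n)%N by exact: leq_trans hn.
split; first exact: weak_Besicovitch_density.
exact: density_weak_Besicovitch.
Qed.
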